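(* Let $\beta>0$ and let $W_1,W_2:\mathbb{R}\to\mathbb{R}$ belong to $L^1_{\rm loc}(\mathbb{R})$ with $e^{-\beta W_2}\in W^{1,1}_{\rm loc}(\mathbb{R})$. For $f\in\mathbb{R}$ write $W_{1f}(x)=W_1(x)-fx$. Assume that $W_2$ is bounded from below and $\int_{\mathbb{R}}(1+|x|^p)e^{-\beta W_2(x)}\,dx<+\infty$ for some $p\ge1$, and that for every $f\in\mathbb{R}$ the function $W_{1f}$ is bounded from below, $e^{-\beta W_{1f}}\in W^{1,1}_{\rm loc}(\mathbb{R})$ and $\int_{\mathbb{R}}(1+|x|^p)e^{-\beta W_{1f}(x)}\,dx<+\infty$. With the notation $y^\star(f)$, $\Lambda(\xi)$, $F_\infty$, $\sigma^2(f)$ of the context, assume that $\xi\mapsto\ln\Lambda(\xi)$ is convex and that $\sigma^2(f)\neq0$ for almost every $f\in\mathbb{R}$. Then for every $x\in\mathbb{R}$ the supremum defining $F_\infty(x)$ is attained at a unique point $\xi(x)$, $F_\infty'(x)=\xi(x)/\beta$, and the functions $f\mapsto y^\star(f)$ and $x\mapsto F_\infty'(x)$ are inverse to each other: $$y^\star(F_\infty'(x))=x\quad\text{for all }x\in\mathbb{R},\qquad F_\infty'(y^\star(f))=f\quad\text{for all }f\in\mathbb{R}.$$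
   Context: For $f\in\mathbb{R}$ let $$K_f(x,y)=\exp\left[-\beta W_2(x+y)-\tfrac\beta2W_{1f}(x)-\tfrac\beta2W_{1f}(y)\right],$$ $$\lambda_f=\max_{\psi\in L^2(\mathbb{R})}\left\{\int_{\mathbb{R}^2}\psi(y)\psi(z)K_f(y,z)\,dy\,dz;\ \int_{\mathbb{R}}\psi^2=1\right\},$$ and let $\psi_f$ be the maximizer, unique up to sign and chosen such that $\psi_f>0$. The macroscopic elongation for a prescribed force $f$ is $$y^\star(f)=\int_{\mathbb{R}}y\,\psi_f^2(y)\,dy.$$ For $\xi\in\mathbb{R}$, $\Lambda(\xi)$ is defined by: $\lambda_0\Lambda(\xi)$ is the largest eigenvalue of the self-adjoint compact operator on $L^2(\mathbb{R})$ $$(\overline Q_\xi\varphi)(y)=\int_{\mathbb{R}}\varphi(x)\,e^{\xi y/2}\,e^{\xi x/2}\,K_0(x,y)\,dx,$$ where $K_0,\lambda_0$ are $K_f,\lambda_f$ for $f=0$. The macroscopic (free) energy for a prescribed elongation $x$ is $$F_\infty(x)=\frac1\beta\sup_{\xi\in\mathbb{R}}\left(\xi x-\ln\Lambda(\xi)\right).$$ Let $g_f(x,y)=\dfrac{\psi_f(y)}{\lambda_f\psi_f(x)}K_f(x,y)$; it is a Markov transition density with invariant probability density $\psi_f^2$. Then $$\sigma^2(f)=\int_{\mathbb{R}}(x-y^\star(f))^2\psi_f^2(x)\,dx+2\sum_{i\ge2}\mathbb{E}\left[(\widetilde Y_i-y^\star(f))(\widetilde Y_1-y^\star(f))\right],$$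 where $(\widetilde Y_i)_{i\ge1}$ is the Markov chain with transition kernel $g_f(x,y)\,dy$ and initial law $\psi_f^2(y)\,dy$. *)

(* Defs.v *)
From HB Require Import structures.
From mathcomp Require Import all_boot all_order all_algebra.
From mathcomp Require Import all_classical all_reals all_analysis.
Import Order.TTheory GRing.Theory Num.Theory.
Import numFieldNormedType.Exports.

Set Implicit Arguments.
Unset Strict Implicit.
Unset Printing Implicit Defensive.

Local Open Scope classical_set_scope.
Local Open Scope ring_scope.

Section FunctionSpaces.
Context {R : realType}.
Notation mu := (@lebesgue_measure R).

Definition loc_integrable (u : R -> R) : Prop := locally_integrable [set: R] u.

Definition test_function (phi : R -> R) : Prop :=
  (forall n x, derivable (derive1n n phi) x 1) /\
  compact (closure [set x | phi x != 0]).

Definition weak_derivative (u v : R -> R) : Prop :=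
  forall phi, test_function phi ->
    \int[mu]_x (u x * derive1 phi x) = - \int[mu]_x (v x * phi x).

Definition W11_loc (u : R -> R) : Prop :=
  loc_integrable u /\ exists2 v, loc_integrable v & weak_derivative u v.

(* [L^1_loc] functions are only defined almost everywhere, so lower bounds are
   essential ones. *)
Definition ess_bounded_below (u : R -> R) : Prop :=
  exists m : R, {ae mu, forall x, m <= u x}.

Definition L2 : set (R -> R) := [set psi | psi \in Lfun mu 2%:E].

(* The maximum of [A], if there is one (and [0] otherwise). *)
Definition maximum (A : set R) : R := xget 0 [set m | A m /\ ubound A m].

End FunctionSpaces.

Section MarkovChain.
Context {R : realType}.
Notation mu := (@lebesgue_measure R).

(* [Y 0], [Y 1], ... is a Markov chain with initial law [rho x dx] and
   transition kernel [g x y dy], i.e.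
     P (Y_(n+1) \in B | Y_0, ..., Y_n) = \int_B g (Y_n, y) dy   a.s.,
   the conditional probability being tested on the events
   {Y_0 \in A_0, ..., Y_n \in A_n}, which generate sigma(Y_0, ..., Y_n) and are
   stable under intersection. *)
Definition is_markov_chain d (T : measurableType d) (P : probability T R)
    (Y : nat -> {RV P >-> R}) (rho : R -> R) (g : R -> R -> R) : Prop :=
  (forall A : set R, measurable A ->
     P (Y 0%N @^-1` A) = (\int[mu]_(x in A) (rho x)%:E)%E) /\
  (forall (n : nat) (A : nat -> set R) (B : set R),
     (forall i, measurable (A i)) -> measurable B ->
     let E := \bigcap_(i in [set i | (i <= n)%N]) (Y i @^-1` A i) in
     P (E `&` Y n.+1 @^-1` B) =
     (\int[P]_(w in E) \int[mu]_(y in B) (g (Y n w) y)%:E)%E).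

End MarkovChain.

Section Model.
Context {R : realType}.
Notation mu := (@lebesgue_measure R).
Variables (beta : R) (W1 W2 : R -> R).

Definition W1f (f x : R) : R := W1 x - f * x.

Definition K (f x y : R) : R :=
  expR (- beta * W2 (x + y) - beta / 2 * W1f f x - beta / 2 * W1f f y).

Definition energy (f : R) (psi : R -> R) : R :=
  \int[(mu \x mu)%E]_z (psi z.1 * psi z.2 * K f z.1 z.2).

Definition unit_L2 : set (R -> R) :=
  [set psi | L2 psi /\ \int[mu]_x (psi x ^+ 2) = 1].

Definition lambda (f : R) : R := maximum [set energy f psi | psi in unit_L2].

Definition positive_maximizer (f : R) (psi : R -> R) : Prop :=
  [/\ unit_L2 psi, energy f psi = lambda f & {ae mu, forall x, 0 < psi x}].

(* A positive maximizer is unique only up to a.e. equality; [psi f] is some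
   representative of it. *)
Definition psi (f : R) : R -> R := xget (cst 0) [set u | positive_maximizer f u].

Definition ystar (f : R) : R := \int[mu]_y (y * psi f y ^+ 2).

Definition Qbar (xi : R) (phi : R -> R) (y : R) : R :=
  \int[mu]_x (phi x * expR (xi * y / 2) * expR (xi * x / 2) * K 0 x y).

Definition Qbar_eigenvalue (xi m : R) : Prop :=
  exists phi, [/\ L2 phi, ~ {ae mu, forall x, phi x = 0} &
    {ae mu, forall y, Qbar xi phi y = m * phi y}].

Definition Lambda (xi : R) : R := maximum [set m | Qbar_eigenvalue xi m] / lambda 0.

Definition legendre (x xi : R) : R := xi * x - ln (Lambda xi).

Definition F_infty (x : R) : R := beta^-1 * sup [set legendre x xi | xi in setT].

Definition sup_attained_at (x xi : R) : Prop :=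
  forall eta, legendre x eta <= legendre x xi.

Definition g (f x y : R) : R := psi f y / (lambda f * psi f x) * K f x y.

(* [Y k] is the state called Y~_(k+1) when the chain is numbered from 1, so the
   sum over i >= 2 is a sum over k >= 1. *)
Definition chain_variance (f : R) d (T : measurableType d) (P : probability T R)
    (Y : nat -> {RV P >-> R}) : R :=
  \int[mu]_x ((x - ystar f) ^+ 2 * psi f x ^+ 2) +
  2 * limn (fun n => \sum_(1 <= k < n)
    fine ('E_P[fun w => (Y k w - ystar f) * (Y 0%N w - ystar f)])).

(* The value does not depend on the probability space carrying the chain, only
   on the law of the chain. *)
Definition sigma2 (f : R) : R := xget 0
  [set s | exists d (T : measurableType d) (P : probability T R)
             (Y : nat -> {RV P >-> R}),
           is_markov_chain Y (fun y => psi f y ^+ 2) (g f) /\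
           s = chain_variance f Y].

End Model.

(* Main.v *)
Require Import Defs.
From HB Require Import structures.
From mathcomp Require Import all_boot all_order all_algebra.
From mathcomp Require Import all_classical all_reals all_analysis.
From mathcomp Require Import measurable_realfun ring lra.

(** At force [xi / beta] the kernel [K] is the kernel of [Qbar xi], so
    [Lambda xi = lambda (xi / beta) / lambda 0].  Testing [lambda (f + h)] with
    the ground state at force [f], Jensen's inequality gives
    [ln (lambda f) + beta * h * ystar f < ln (lambda (f + h))] for [h <> 0]: the
    derivative of [ln Lambda] at [beta * f] can only be [ystar f], [ystar] is
    strictly increasing, and [beta * f] is the unique maximizer in the Legendre
    transform at [x = ystar f].  What remains is that [ystar] is a continuous
    surjection; trial functions supported far away make it unbounded on both
    sides.

    Existence and stability of the ground state rest on the quadratic form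
    [form u u] being concave in the density [u ^ 2]: if two nonnegative
    normalized functions almost maximize it, [sqrt (u ^ 2 + v ^ 2)] cannot do
    better, which forces the exterior product of [u] and [v] to be small, hence
    [u] and [v] to be close.  This replaces weak compactness and the spectral
    theorem: maximizing sequences are Cauchy, and ground states depend
    continuously on the force. *)

Import Order.TTheory GRing.Theory Num.Theory.
Import numFieldNormedType.Exports.

Set Implicit Arguments.
Unset Strict Implicit.
Unset Printing Implicit Defensive.

Local Open Scope classical_set_scope.
Local Open Scope ring_scope.

(** * Square-integrable functions *)

(** With [s = sqrt (u^2 + v^2)] and primes for the second variable, [s s' - u u' - v v'] is the
    defect in the Cauchy-Schwarz inequality for the plane vectors [(u, v)] and [(u', v')]; it
    vanishes only where these are parallel, that is, where the exterior product does. Closeness then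
    comes from a Gram identity: [form u u * form v v - form u v ^ 2] is half the pairing of the
    exterior products of [u, v] and of [T u, T v]. If it is small, [form u v] is close to [lam], so
    the norm of [u + v] is close to 2. The obstacle is that the kernel, though positive, need not be
    bounded below relative to its weight: concavity controls the exterior product only in the L^1
    norm weighted by the kernel, whereas the pairing carries the larger weight [a(x) a(y)]. A
    cut-off and dominated convergence bridge the two. Jensen's inequality is applied under the pair
    density [ground(x) ground(y) ker(x, y) / lambda], whose marginals are the squared ground state;
    the mean of [x + y] is therefore [2 * ystar]. *)

Section SquareIntegrable.
Context d (T : measurableType d) (R : realType).
Variable mu : {measure set T -> \bar R}.
Implicit Types f g u v : T -> R.

Local Notation itg f := (mu.-integrable setT (EFin \o f)).

Lemma itg_measurable f : itg f -> measurable_fun setT f.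
Proof. by move=> /measurable_int/measurable_EFinP. Qed.

Lemma itg_le f g : measurable_fun setT f -> itg g ->
  (forall x, `|f x| <= g x) -> itg f.
Proof.
move=> mf ig fg; apply: (le_integrable _ _ _ ig) => //.
  exact/measurable_EFinP.
by move=> x _ /=; rewrite lee_fin (le_trans (fg x))// ler_norm.
Qed.

Lemma itgD f g : itg f -> itg g -> itg (fun x => f x + g x).
Proof. by move=> fi gi; apply: (integrableD _ fi gi). Qed.

Lemma itgB f g : itg f -> itg g -> itg (fun x => f x - g x).
Proof. by move=> fi gi; apply: (integrableB _ fi gi). Qed.

Lemma itgZ c f : itg f -> itg (fun x => c * f x).
Proof. by move=> fi; apply: (integrableZl _ c fi). Qed.

Lemma IntD f g : itg f -> itg g ->
  \int[mu]_x (f x + g x) = \int[mu]_x f x + \int[mu]_x g x.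
Proof. exact: RintegralD. Qed.

Lemma IntB f g : itg f -> itg g ->
  \int[mu]_x (f x - g x) = \int[mu]_x f x - \int[mu]_x g x.
Proof. exact: RintegralB. Qed.

Lemma IntZ c f : itg f -> \int[mu]_x (c * f x) = c * \int[mu]_x f x.
Proof. exact: RintegralZl. Qed.

Lemma eq_Int f g : f =1 g -> \int[mu]_x f x = \int[mu]_x g x.
Proof. by move=> /funext ->. Qed.

Lemma le_Int f g : itg f -> itg g -> (forall x, f x <= g x) ->
  \int[mu]_x f x <= \int[mu]_x g x.
Proof. by move=> fi gi fg; apply: le_Rintegral => //. Qed.

Lemma Int_ge0 f : (forall x, 0 <= f x) -> 0 <= \int[mu]_x f x.
Proof. by move=> f0; apply: Rintegral_ge0. Qed.

Lemma ae_imp (P Q : T -> Prop) : (forall x, P x -> Q x) ->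
  {ae mu, forall x, P x} -> {ae mu, forall x, Q x}.
Proof. by move=> PQ; apply: filterS. Qed.

Lemma ae_eq_Int f g : measurable_fun setT f -> measurable_fun setT g ->
  {ae mu, forall x, f x = g x} -> \int[mu]_x f x = \int[mu]_x g x.
Proof.
move=> mf mg fg; congr fine; apply: ae_eq_integral => //.
- exact/measurable_EFinP.
- exact/measurable_EFinP.
- by apply: filterS fg => x /= ->.
Qed.

Lemma Int_eq0 f : itg f -> (forall x, 0 <= f x) -> \int[mu]_x f x = 0 ->
  {ae mu, forall x, f x = 0}.
Proof.
move=> fi f0 I0.
have : (\int[mu]_x `|(EFin \o f) x| = 0)%E.
  rewrite -[RHS]/(0%:E) -I0 fineK; last exact: integrable_fin_num.
  by apply: eq_integral => x _ /=; rewrite ger0_norm.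
move/ae_eq_integral_abs => /(_ measurableT (measurable_int _ fi)).
by apply: filterS => x /= /(_ I) [].
Qed.

Definition sqi u := measurable_fun setT u /\ itg (fun x => u x ^+ 2).

(** Links the pointwise functions used throughout with the space behind [L2] in the statement. *)
Lemma sqi_Lfun u : sqi u <-> u \in Lfun mu 2%:E.
Proof.
split=> [[mu_ iu]|Lu]; last first.
  split; last exact: Lfun2_integrable_sqr.
  by move: Lu; rewrite inE => /andP[]; rewrite inE.
rewrite inE; apply/andP; split; rewrite inE//= /finite_norm.
rewrite unlock /=.
move/integrableP : iu => [_ iu].
apply: poweR_lty; apply: le_lt_trans iu.
apply: ge0_le_integral => //.

- apply/measurable_EFinP.
  apply: (@measurableT_comp _ _ _ _ _ _ (fun x : R => x `^ 2)) => //.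
  exact: measurableT_comp.
- apply/measurable_EFinP; apply: measurableT_comp => //.
  exact: measurable_funX.
- by move=> x _ /=; rewrite lee_fin powR_mulrn// normrX.
Qed.

Lemma sqi_measurable u : sqi u -> measurable_fun setT u.
Proof. by case. Qed.

Lemma sqi_proj u : sqi u -> itg (fun x => u x ^+ 2).
Proof. by case. Qed.

Lemma itgM u v : sqi u -> sqi v -> itg (fun x => u x * v x).
Proof.
move=> [mU iu] [mv iv].
apply: (@itg_le _ (fun x => u x ^+ 2 + v x ^+ 2)).
- exact: measurable_funM.
- exact: itgD.
- move=> x; rewrite normrM -(real_normK (num_real (u x))).
  rewrite -(real_normK (num_real (v x))).
  by have := sqr_ge0 (`|u x| - `|v x|);
    have := normr_ge0 (u x); have := normr_ge0 (v x); nra.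
Qed.

Lemma sqi_le u v : measurable_fun setT u -> sqi v ->
  (forall x, `|u x| <= `|v x|) -> sqi u.
Proof.
move=> mU [mv iv] uv; split=> //.
apply: (itg_le _ iv); first exact: measurable_funX.
by move=> x; rewrite normrX -[leRHS]real_normK ?num_real// lerXn2r ?nnegrE.
Qed.

Lemma sqiZ c u : sqi u -> sqi (fun x => c * u x).
Proof.
move=> [mU iu]; split; first exact: measurable_funM.
by under eq_fun do rewrite exprMn; exact: itgZ.
Qed.

Lemma sqiD u v : sqi u -> sqi v -> sqi (fun x => u x + v x).
Proof.
move=> su sv; have [mU iu] := su; have [mv iv] := sv.
split; first exact: measurable_funD.
apply: (eq_integrable _ (EFin \o (fun x => u x ^+ 2 + 2 * (u x * v x) + v x ^+ 2))) => //.
  by move=> x _ /=; congr (_%:E); ring.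
by apply: itgD => //; apply: itgD => //; apply: itgZ; exact: itgM.
Qed.

Lemma sqiB u v : sqi u -> sqi v -> sqi (fun x => u x - v x).
Proof.
move=> su sv; under eq_fun do rewrite -mulN1r.
by apply: sqiD => //; exact: sqiZ.
Qed.

Lemma sqi_norm u : sqi u -> sqi (fun x => `|u x|).
Proof.
move=> su; apply: (sqi_le _ su) => [|x]; last by rewrite normr_id.
by apply: measurableT_comp => //; exact: sqi_measurable.
Qed.

Definition ip u v := \int[mu]_x (u x * v x).

Lemma ipC u v : ip u v = ip v u.
Proof. by apply: eq_Int => x; rewrite mulrC. Qed.

Lemma ip_ge0 u : 0 <= ip u u.
Proof. by apply: Int_ge0 => x; rewrite -expr2 sqr_ge0. Qed.

Lemma ipDl u v g : sqi u -> sqi v -> sqi g ->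
  ip (fun x => u x + v x) g = ip u g + ip v g.
Proof.
move=> su sv sg; rewrite /ip -IntD; [|exact: itgM..].
by apply: eq_Int => x; rewrite mulrDl.
Qed.

Lemma ipBl u v g : sqi u -> sqi v -> sqi g ->
  ip (fun x => u x - v x) g = ip u g - ip v g.
Proof.
move=> su sv sg; rewrite /ip -IntB; [|exact: itgM..].
by apply: eq_Int => x; rewrite mulrBl.
Qed.

Lemma ipZl c u g : sqi u -> sqi g -> ip (fun x => c * u x) g = c * ip u g.
Proof.
move=> su sg; rewrite /ip -IntZ; last exact: itgM.
by apply: eq_Int => x; rewrite mulrA.
Qed.

Lemma ip_sqrD u v : sqi u -> sqi v ->
  ip (fun x => u x + v x) (fun x => u x + v x) = ip u u + 2 * ip u v + ip v v.
Proof.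
move=> su sv; rewrite ipDl//; last exact: sqiD.
by rewrite ipC ipDl// [X in _ + X]ipC ipDl// (ipC v u); ring.
Qed.

Lemma ip_sqrB u v : sqi u -> sqi v ->
  ip (fun x => u x - v x) (fun x => u x - v x) = ip u u - 2 * ip u v + ip v v.
Proof.
move=> su sv; rewrite ipBl//; last exact: sqiB.
by rewrite ipC ipBl// [X in _ - X]ipC ipBl// (ipC v u); ring.
Qed.

Lemma ip_sqrZ c u : sqi u ->
  ip (fun x => c * u x) (fun x => c * u x) = c ^+ 2 * ip u u.
Proof.
by move=> su; rewrite ipZl//; [rewrite ipC ipZl//; ring|exact: sqiZ].
Qed.

Lemma ip_sqrD_le u v : sqi u -> sqi v ->
  ip (fun x => u x + v x) (fun x => u x + v x) <= 2 * ip u u + 2 * ip v v.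
Proof.
move=> su sv; rewrite ip_sqrD//; have := ip_ge0 (fun x => u x - v x).
by rewrite ip_sqrB//; lra.
Qed.

Lemma ip_norm u : ip (fun x => `|u x|) (fun x => `|u x|) = ip u u.
Proof.
by apply: eq_Int => x; rewrite -normrM ger0_norm// -expr2 sqr_ge0.
Qed.

Lemma ip_eq0 u : sqi u -> ip u u = 0 -> {ae mu, forall x, u x = 0}.
Proof.
move=> su /Int_eq0; have := itgM su su => i /(_ i).
have h x : 0 <= u x * u x by rewrite -expr2 sqr_ge0.
by move=> /(_ h); apply: filterS => x /= /eqP; rewrite mulf_eq0 orbb => /eqP.
Qed.

Lemma cauchy_schwarz u v : sqi u -> sqi v -> ip u v ^+ 2 <= ip u u * ip v v.
Proof.
move=> su sv.
have q t : 0 <= ip u u - 2 * (t * ip u v) + t ^+ 2 * ip v v.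
  have := ip_ge0 (fun x => u x - t * v x).
  rewrite ip_sqrB//; last exact: sqiZ.
  by rewrite ip_sqrZ// (ipC u) ipZl// (ipC v).
have [v0|v0] := eqVneq (ip v v) 0.
  rewrite v0 mulr0; have [->|uv0] := eqVneq (ip u v) 0; first by rewrite expr0n.
  (* Here [q] is affine in [t]; this choice would give it the value -1. *)
  have := q ((ip u u + 1) / (2 * ip u v)).
  have -> : 2 * ((ip u u + 1) / (2 * ip u v) * ip u v) = ip u u + 1 by field.
  by rewrite v0 mulr0; lra.
have vv : 0 < ip v v by rewrite lt_neqAle eq_sym v0 ip_ge0.
(* The minimizer of the quadratic polynomial [q]. *)
have := q (ip u v / ip v v).
have -> : ip u u - 2 * (ip u v / ip v v * ip u v) + (ip u v / ip v v) ^+ 2 * ip v v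
  = (ip u u * ip v v - ip u v ^+ 2) / ip v v by field.
by rewrite pmulr_lge0 ?invr_gt0// subr_ge0.
Qed.

End SquareIntegrable.

(** * Fubini's theorem and tensor products for real-valued integrals *)

Section ProductIntegrals.
Context d (T : measurableType d) (R : realType).
Variable mu : {sigma_finite_measure set T -> \bar R}.
Implicit Types (u v p q : T -> R) (F : T * T -> R).

Local Notation m2 := (mu \x mu)%E.
Local Notation itg m f := ((m).-integrable setT (EFin \o f)).

Lemma measurable_tensor u v : measurable_fun setT u -> measurable_fun setT v ->
  measurable_fun setT (fun z : T * T => u z.1 * v z.2).
Proof.
move=> mU mv; apply: measurable_funM.
  exact: (measurableT_comp mU measurable_fst).
exact: (measurableT_comp mv measurable_snd).
Qed.

Lemma itg_tensor p q : itg mu p -> itg mu q ->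
  itg m2 (fun z : T * T => p z.1 * q z.2).
Proof.
move=> ip_ iq.
have mp := itg_measurable ip_; have mq := itg_measurable iq.
apply/integrable12ltyP.
  by apply/measurable_EFinP; exact: measurable_tensor.
have mn (r : T -> R) : measurable_fun setT r -> measurable_fun setT (fun y : T => `|r y|%:E).
  by move=> mr; apply/measurable_EFinP; exact: measurableT_comp.
have /integrableP[_ q1] := iq; have /integrableP[_ p1] := ip_.
have -> : (\int[mu]_x \int[mu]_y `|(p x * q y)%:E| =
    (\int[mu]_x `|p x|%:E) * \int[mu]_y `|q y|%:E)%E.
  transitivity (\int[mu]_x (`|p x|%:E * \int[mu]_y `|q y|%:E))%E.
    apply: eq_integral => x _; rewrite -ge0_integralZl//; last exact: mn.
    by apply: eq_integral => y _; rewrite /= normrM EFinM.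
  by rewrite ge0_integralZr//; [exact: mn|exact: integral_ge0].
apply: lte_mul_pinfty => //; first exact: integral_ge0.
by rewrite ge0_fin_numE//; exact: integral_ge0.
Qed.

(** Integrability of every section, and not just of almost every one, keeps each inner integral
    finite, so that [fine] can be taken inside. *)
Lemma Int_iterated2 F : itg m2 F -> (forall y, itg mu (fun x => F (x, y))) ->
  \int[m2]_z F z = \int[mu]_y \int[mu]_x F (x, y).
Proof.
move=> iF iFy; congr fine; rewrite -integral21_prod_meas1//.
by apply: eq_integral => y _; rewrite fineK//; exact: integrable_fin_num (iFy y).
Qed.

Lemma Int_iterated1 F : itg m2 F -> (forall x, itg mu (fun y => F (x, y))) ->
  \int[m2]_z F z = \int[mu]_x \int[mu]_y F (x, y).
Proof.
move=> iF iFy; congr fine; rewrite -integral12_prod_meas1//.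
by apply: eq_integral => y _; rewrite fineK//; exact: integrable_fin_num (iFy y).
Qed.

Lemma measurable_iterated2 F : itg m2 F ->
  measurable_fun setT (fun y => \int[mu]_x F (x, y)).
Proof.
move=> iF; apply: (@measurableT_comp _ _ _ _ _ _ fine _ (fubini_G mu (EFin \o F))).
  exact: fine_measurable.
exact: measurable_fubini_G iF.
Qed.

Lemma Int_tensor p q : itg mu p -> itg mu q ->
  \int[m2]_z (p z.1 * q z.2) = (\int[mu]_x p x) * \int[mu]_x q x.
Proof.
move=> ip_ iq; rewrite Int_iterated2/=; last 2 first.
- exact: itg_tensor.
- by move=> y; under eq_fun do rewrite mulrC; exact: itgZ.
rewrite -IntZ//; apply: eq_Int => y.
by under eq_Rintegral do rewrite mulrC; rewrite IntZ// mulrC.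
Qed.

Lemma sqi_tensor u v : sqi mu u -> sqi mu v ->
  sqi m2 (fun z : T * T => u z.1 * v z.2).
Proof.
move=> [mU iu] [mv iv]; split; first exact: measurable_tensor.
by under eq_fun do rewrite exprMn; exact: itg_tensor iu iv.
Qed.

Lemma ip_tensor u v p q : sqi mu u -> sqi mu v -> sqi mu p -> sqi mu q ->
  ip m2 (fun z : T * T => u z.1 * v z.2) (fun z => p z.1 * q z.2) =
  ip mu u p * ip mu v q.
Proof.
move=> su sv sp sq.
transitivity (\int[m2]_z ((u z.1 * p z.1) * (v z.2 * q z.2))).
  by apply: eq_Int => z; ring.
exact: (Int_tensor (itgM su sp) (itgM sv sq)).
Qed.

End ProductIntegrals.
(** * Positive kernels of the form k(x, y) a(x) a(y) *)

(** The weight carries the integrability and makes the kernel Hilbert-Schmidt; the link is bounded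
    above but may come arbitrarily close to zero. As the weight is positive, [weight_norm_gt0] just
    excludes the zero measure. *)
Record bounded_kernel d (T : measurableType d) (R : realType)
    (mu : {measure set T -> \bar R}) (a : T -> R) (k : T * T -> R) (C : R) : Prop :=
  BoundedKernel {
    weight_gt0 : forall x, 0 < a x ;
    weight_sqi : sqi mu a ;
    weight_norm_gt0 : 0 < ip mu a a ;
    link_measurable : measurable_fun setT k ;
    link_gt0 : forall z, 0 < k z ;
    link_le : forall z, k z <= C ;
    link_sym : forall x y, k (x, y) = k (y, x) }.

Definition ker (T : Type) (R : realType) (a : T -> R) (k : T * T -> R) (z : T * T) : R :=
  k z * (a z.1 * a z.2).

Definition form d (T : measurableType d) (R : realType)
    (mu : {sigma_finite_measure set T -> \bar R}) a k (u v : T -> R) : R :=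
  \int[(mu \x mu)%E]_z (u z.1 * v z.2 * ker a k z).

Definition opT d (T : measurableType d) (R : realType)
    (mu : {sigma_finite_measure set T -> \bar R}) a k (u : T -> R) (y : T) : R :=
  \int[mu]_x (u x * ker a k (x, y)).

Definition normalized d (T : measurableType d) (R : realType)
    (mu : {measure set T -> \bar R}) (u : T -> R) := sqi mu u /\ ip mu u u = 1.

Definition form_values d (T : measurableType d) (R : realType)
    (mu : {sigma_finite_measure set T -> \bar R}) a k : set R :=
  [set form mu a k u u | u in [set u | normalized mu u]].

(** A supremum, meaningful before attainment is known; [exists_maximizer] turns it into a
    maximum. *)
Definition lam d (T : measurableType d) (R : realType)
    (mu : {sigma_finite_measure set T -> \bar R}) a k : R :=
  sup (form_values mu a k).

Section PositiveKernel.
Context d (T : measurableType d) (R : realType).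
Variable mu : {sigma_finite_measure set T -> \bar R}.
Local Notation m2 := (mu \x mu)%E.
Local Notation itg m f := ((m).-integrable setT (EFin \o f)).

Variables (a : T -> R) (k : T * T -> R) (C : R).
Hypothesis hK : bounded_kernel mu a k C.

Local Notation ker := (ker a k).
Local Notation form := (form mu a k).
Local Notation opT := (opT mu a k).
Local Notation normalized := (normalized mu).
Local Notation form_values := (form_values mu a k).
Local Notation lam := (lam mu a k).

Let a_gt0 := weight_gt0 hK.
Let sqi_a := weight_sqi hK.
Let a_norm := weight_norm_gt0 hK.
Let mk := link_measurable hK.
Let k_gt0 := link_gt0 hK.
Let k_le := link_le hK.
Let k_sym := link_sym hK.

Let C_gt0 : 0 < C.
Proof.
rewrite ltNge; apply/negP => C0.
have nT (x : T) : False by have := le_trans (k_le (x, x)) C0; rewrite leNgt k_gt0.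
have a0 : a = cst 0 by apply/funext => x; case: (nT x).
have : ip mu a a = 0 by rewrite a0 /ip /= Rintegral_cst ?mul0r// mul0r.
by move/eqP; rewrite gt_eqF.
Qed.

Implicit Types (u v : T -> R).

Let N := ip mu a a.
Let M2 := C ^+ 2 * N.
Let M2_gt0 : 0 < M2. Proof. by rewrite mulr_gt0 ?exprn_gt0. Qed.

(** * The quadratic form and its integral operator *)

Lemma ker_gt0 z : 0 < ker z.
Proof. by rewrite /ker !mulr_gt0. Qed.

Lemma ker_sym x y : ker (x, y) = ker (y, x).
Proof. by rewrite /ker k_sym /=; ring. Qed.

Lemma ker_le z : ker z <= C * (a z.1 * a z.2).
Proof. by rewrite /ker ler_wpM2r// ltW// mulr_gt0. Qed.

Let ma : measurable_fun setT a. Proof. by case: sqi_a. Qed.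

Let mker : measurable_fun setT ker.
Proof. by apply: measurable_funM => //; exact: measurable_tensor. Qed.

Lemma sqi_ker : sqi m2 ker.
Proof.
apply: (sqi_le mker (sqiZ C (sqi_tensor sqi_a sqi_a))) => z.
by rewrite ger0_norm ?(ltW (ker_gt0 z))// (le_trans (ker_le z))// ler_norm.
Qed.

Lemma sqi_ker2 y : sqi mu (fun x => ker (x, y)).
Proof.
apply: (@sqi_le _ _ _ _ _ (fun x => C * a y * a x)).
- exact: (measurableT_comp mker (pair2_measurable y)).
- exact: sqiZ.
- move=> x; rewrite ger0_norm ?(ltW (ker_gt0 _))// (le_trans (ker_le _))//=.
  by rewrite (mulrC (a x)) mulrA ler_norm.
Qed.

Lemma itg_ker2 u y : sqi mu u -> itg mu (fun x => u x * ker (x, y)).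
Proof. by move=> su; apply: itgM => //; exact: sqi_ker2. Qed.

Lemma itg_form u v : sqi mu u -> sqi mu v ->
  itg m2 (fun z => u z.1 * v z.2 * ker z).
Proof.
move=> su sv; apply: (itgM (u := fun z : T * T => u z.1 * v z.2)).
  exact: sqi_tensor.
exact: sqi_ker.
Qed.

(** Stronger than an operator norm bound: [T u] is dominated pointwise by the weight. This yields
    convergence at every point and, later, the decay of ground states. *)
Lemma opT_sqr_le u y : sqi mu u -> (opT u y) ^+ 2 <= M2 * ip mu u u * a y ^+ 2.
Proof.
move=> su; apply: (le_trans (cauchy_schwarz su (sqi_ker2 y))).
rewrite [leRHS](_ : _ = ip mu u u * ((C * a y) ^+ 2 * N)); last by rewrite /M2; ring.
rewrite ler_wpM2l ?ip_ge0// -ip_sqrZ//.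
apply: le_Int => [||x].
- by apply: itgM; exact: sqi_ker2.
- by apply: itgM; exact: sqiZ.
- have kl : ker (x, y) <= C * a y * a x by rewrite -mulrA (mulrC (a y)); exact: ker_le.
  by apply: ler_pM => //; exact: ltW (ker_gt0 _).
Qed.

(** The function [u(x) ker(x, y)] need not be integrable in both variables, so Fubini is applied
    after multiplication by [a(y)], which is then divided out. *)
Lemma measurable_opT u : sqi mu u -> measurable_fun setT (opT u).
Proof.
move=> su; have -> : opT u = (fun y => a y `^ (-1) * \int[mu]_x (u x * a y * ker (x, y))).
  apply/funext => y; rewrite powR_inv1 ?ltW//.
  have -> : \int[mu]_x (u x * a y * ker (x, y)) = a y * opT u y.
    rewrite -IntZ; last exact: itg_ker2.
    by apply: eq_Int => x; ring.
  by rewrite mulKf// gt_eqF.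
apply: measurable_funM; first exact: (measurableT_comp (measurable_powR (- 1)) ma).
exact: (measurable_iterated2 (itg_form su sqi_a)).
Qed.

Lemma sqi_opT u : sqi mu u -> sqi mu (opT u).
Proof.
move=> su; apply: (@sqi_le _ _ _ _ _ (fun y => Num.sqrt (M2 * ip mu u u) * a y)).
- exact: measurable_opT.
- exact: sqiZ.
- move=> y; rewrite -(@ler_pXn2r _ 2%N) ?nnegrE//.
  rewrite !real_normK ?num_real// exprMn sqr_sqrtr ?opT_sqr_le//.
  by rewrite mulr_ge0 ?ip_ge0// ltW.
Qed.

Lemma opTD u v y : sqi mu u -> sqi mu v ->
  opT (fun x => u x + v x) y = opT u y + opT v y.
Proof.
move=> su sv; rewrite /opT -IntD; [|exact: itg_ker2..].
by apply: eq_Int => x; rewrite mulrDl.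
Qed.

Lemma opTZ c u y : sqi mu u -> opT (fun x => c * u x) y = c * opT u y.
Proof.
move=> su; rewrite /opT -IntZ; last exact: itg_ker2.
by apply: eq_Int => x; rewrite mulrA.
Qed.

Lemma opTB u v y : sqi mu u -> sqi mu v ->
  opT (fun x => u x - v x) y = opT u y - opT v y.
Proof.
move=> su sv; rewrite /opT -IntB; [|exact: itg_ker2..].
by apply: eq_Int => x; rewrite mulrBl.
Qed.

Lemma form_opT u v : sqi mu u -> sqi mu v -> form u v = ip mu (opT u) v.
Proof.
move=> su sv; rewrite /form Int_iterated2/=; last 2 first.
- exact: itg_form.
- move=> y /=; have := itgZ (v y) (itg_ker2 y su).
  by apply: eq_integrable => // x _ /=; congr (_%:E); ring.
apply: eq_Int => y; rewrite mulrC -IntZ; last exact: itg_ker2.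
by apply: eq_Int => x; ring.
Qed.

Lemma form_sym u v : sqi mu u -> sqi mu v -> form u v = form v u.
Proof.
move=> su sv; rewrite form_opT// /form Int_iterated1/=; last 2 first.
- exact: itg_form.
- move=> y /=; have := itgZ (v y) (itg_ker2 y su).
  by apply: eq_integrable => // x _ /=; congr (_%:E); rewrite ker_sym; ring.
apply: eq_Int => y; rewrite mulrC -IntZ; last exact: itg_ker2.
by apply: eq_Int => x; rewrite ker_sym; ring.
Qed.

Lemma form_sqrD u v : sqi mu u -> sqi mu v ->
  form (fun x => u x + v x) (fun x => u x + v x) =
  form u u + 2 * form u v + form v v.
Proof.
move=> su sv; rewrite (form_opT (sqiD su sv) (sqiD su sv)).
have -> : opT (fun x => u x + v x) = (fun y => opT u y + opT v y).
  by apply/funext => y; exact: opTD.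
have sTu := sqi_opT su; have sTv := sqi_opT sv.
rewrite ipDl//; last exact: sqiD.
rewrite ipC ipDl// [X in _ + X]ipC ipDl//.
rewrite (ipC _ u (opT u)) (ipC _ v (opT u)) (ipC _ u (opT v)) (ipC _ v (opT v)).
rewrite -!form_opT//.
by rewrite (form_sym sv su); ring.
Qed.

Lemma form_sqrZ c u : sqi mu u ->
  form (fun x => c * u x) (fun x => c * u x) = c ^+ 2 * form u u.
Proof.
move=> su; rewrite (form_opT (sqiZ c su) (sqiZ c su)).
have -> : opT (fun x => c * u x) = (fun y => c * opT u y).
  by apply/funext => y; exact: opTZ.
rewrite ipZl//; [|exact: sqi_opT|exact: sqiZ].
by rewrite ipC ipZl//; [rewrite ipC form_opT//; ring|exact: sqi_opT].
Qed.

Lemma formZr c u v : sqi mu u -> sqi mu v -> form u (fun x => c * v x) = c * form u v.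
Proof.
move=> su sv; rewrite !form_opT//; last exact: sqiZ.
by rewrite ipC ipZl//; [rewrite ipC|exact: sqi_opT].
Qed.

Lemma form_sqrB u v : sqi mu u -> sqi mu v ->
  form (fun x => u x - v x) (fun x => u x - v x) =
  form u u - 2 * form u v + form v v.
Proof.
move=> su sv.
have -> : (fun x => u x - v x) = (fun x => u x + (-1) * v x).
  by apply/funext => x; rewrite mulN1r.
rewrite form_sqrD//; last exact: sqiZ.
by rewrite form_sqrZ// formZr//; ring.
Qed.

Lemma form_ge0 u v : (forall x, 0 <= u x) -> (forall x, 0 <= v x) -> 0 <= form u v.
Proof.
by move=> u0 v0; apply: Int_ge0 => z; rewrite !mulr_ge0// ltW// ker_gt0.
Qed.

Lemma form_norm u v : sqi mu u -> sqi mu v ->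
  `|form u v| <= form (fun x => `|u x|) (fun x => `|v x|).
Proof.
move=> su sv; apply: (le_trans (le_normr_Rintegral measurableT (itg_form su sv))).
rewrite le_eqVlt; apply/orP; left; apply/eqP/eq_Int => z.
by rewrite normrM (gtr0_norm (ker_gt0 z)) normrM.
Qed.

(** If the form vanished, [u(x) u(y)] would vanish almost everywhere by positivity of the kernel,
    and the integral of its square is [(ip u u)^2]. *)
Lemma form_gt0 u : sqi mu u -> 0 < ip mu u u -> (forall x, 0 <= u x) ->
  0 < form u u.
Proof.
move=> su u_neq0 u0; rewrite lt_neqAle form_ge0// andbT; apply/eqP => /esym e0.
have i := itg_form su su.
have h : {ae m2, forall z : T * T, u z.1 * u z.2 * ker z = 0}.
  by apply: (Int_eq0 i) => // z; rewrite !mulr_ge0// ltW// ker_gt0.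
have : ip m2 (fun z => u z.1 * u z.2) (fun z => u z.1 * u z.2) = 0.
  rewrite /ip (@ae_eq_Int _ _ _ _ _ (cst 0)).
  - by rewrite Rintegral_cst// mul0r.
  - by apply: measurable_funM; apply: measurable_tensor; case: su.
  - exact: measurable_cst.
  - apply: filterS h => z /= /eqP; rewrite mulf_eq0 (gt_eqF (ker_gt0 z)) orbF.
    by move=> /eqP ->; rewrite mul0r.
rewrite ip_tensor// => /eqP; rewrite mulf_eq0 orbb => /eqP.
by move/eqP; rewrite (gt_eqF u_neq0).
Qed.

Lemma ip_opT_le u : sqi mu u -> ip mu (opT u) (opT u) <= M2 * ip mu u u * N.
Proof.
move=> su; rewrite -IntZ; last exact: itgM.
apply: le_Int => [||x].
- by apply: itgM; exact: sqi_opT.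
- by apply: itgZ; exact: itgM.
- by rewrite -!expr2 opT_sqr_le.
Qed.

Lemma form_sqr_le u : sqi mu u -> form u u ^+ 2 <= M2 * N * ip mu u u ^+ 2.
Proof.
move=> su; rewrite form_opT//; apply: (le_trans (cauchy_schwarz (sqi_opT su) su)).
rewrite [leRHS](_ : _ = M2 * ip mu u u * N * ip mu u u); last by ring.
by rewrite ler_wpM2r ?ip_ge0// ip_opT_le.
Qed.

Lemma normalize u : sqi mu u -> 0 < ip mu u u ->
  normalized (fun x => (Num.sqrt (ip mu u u))^-1 * u x).
Proof.
move=> su u0; split; first exact: sqiZ.
by rewrite ip_sqrZ// exprVn sqr_sqrtr ?ltW// mulVf// gt_eqF.
Qed.

Lemma has_sup_form_values : has_sup form_values.
Proof.
split.
  by eexists; exists (fun x => (Num.sqrt (ip mu a a))^-1 * a x) => //; exact: normalize.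
exists (1 + M2 * N) => _ [u [su u1] <-].
have := form_sqr_le su; rewrite u1 expr1n mulr1 => h.
by have := sqr_ge0 (form u u - 1); nra.
Qed.

Lemma form_le_lam u : sqi mu u -> form u u <= lam * ip mu u u.
Proof.
move=> su; have [u0|u0] := eqVneq (ip mu u u) 0.
  have := form_sqr_le su; rewrite u0 expr0n !mulr0 => h.
  suff -> : form u u = 0 by [].
  by apply/eqP; rewrite -sqrf_eq0 eq_le h sqr_ge0.
have {}u0 : 0 < ip mu u u by rewrite lt_neqAle eq_sym u0 ip_ge0.
have nu := normalize su u0.
have : form (fun x => (Num.sqrt (ip mu u u))^-1 * u x)
            (fun x => (Num.sqrt (ip mu u u))^-1 * u x) <= lam.
  by apply: sup_ubound; [exact: has_sup_form_values.2|eexists; first exact: nu].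
by rewrite form_sqrZ// exprVn sqr_sqrtr ?ip_ge0// ler_pdivrMl// mulrC.
Qed.

Lemma lam_gt0 : 0 < lam.
Proof.
have := form_gt0 sqi_a a_norm (fun x => ltW (a_gt0 x)).
by move=> /lt_le_trans /(_ (form_le_lam sqi_a)); rewrite pmulr_lgt0.
Qed.

(** Since the kernel is positive, replacing [u] by its absolute value can only increase the form. *)
Lemma lam_adherent e : 0 < e ->
  exists u, [/\ normalized u, (forall x, 0 <= u x) & lam - e < form u u].
Proof.
move=> e0; have [_ [u [su u1] <-] h] := sup_adherent e0 has_sup_form_values.
exists (fun x => `|u x|); split => //.
  by split; [exact: sqi_norm|rewrite ip_norm].
by apply: (lt_le_trans h); apply: le_trans (form_norm su su); exact: ler_norm.
Qed.

(** The absolute value also bounds the form from below: [T] lies between [- lam] and [lam]. The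
    residual estimate needs both ends. *)
Lemma form_ge_lam u : sqi mu u -> - (lam * ip mu u u) <= form u u.
Proof.
move=> su; rewrite lerNl.
rewrite (le_trans (ler_norm _))// normrN (le_trans (form_norm su su))//.
by rewrite -(ip_norm mu u) form_le_lam//; exact: sqi_norm.
Qed.

(* Expand [0 <= lam |w|^2 - form w w] at [w = u - (lam u - T u) / (2 lam)]. *)
Lemma resid_le u : sqi mu u ->
  ip mu (fun x => lam * u x - opT u x) (fun x => lam * u x - opT u x) <=
  2 * lam * (lam * ip mu u u - form u u).
Proof.
move=> su; set h := fun x => _.
have sTu := sqi_opT su; have slu := sqiZ lam su.
have sh : sqi mu h by exact: sqiB.
have l0 := lam_gt0.
(* Because [lam - T <= 2 * lam], this step length minimizes the resulting quadratic bound. *)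
pose t := (2 * lam)^-1.
have sth : sqi mu (fun x => t * h x) by exact: sqiZ.
have := form_le_lam (sqiB su sth).
rewrite form_sqrB// ip_sqrB// formZr// form_sqrZ// ip_sqrZ// (ipC _ u) ipZl//.
have -> : ip mu h u = ip mu (fun x => lam * u x - opT u x) u by [].
rewrite (form_opT su sh).
have hh : ip mu h h = lam * ip mu h u - ip mu (opT u) h.
  by rewrite {1}/h ipBl// ipZl// (ipC _ u).
have := form_ge_lam sh.
move: hh; rewrite -/h; move: (ip mu h u) (ip mu (opT u) h) (ip mu h h) (ip mu u u) (form h h) => p q r s w.
move: (form u u) => z -> hw.
have t0 : 0 < t by rewrite invr_gt0 mulr_gt0.
have tl : t * lam = 2^-1 by rewrite /t; field; lra.
move=> H.
have h1 : 0 <= t ^+ 2 * (w + lam * (lam * p - q)).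
  by rewrite mulr_ge0 ?sqr_ge0// -lerBlDr sub0r.
have h2 : t ^+ 2 * (lam * (lam * p - q)) = 2^-1 * (t * (lam * p - q)).
  by rewrite -tl; ring.
have h3 : t * (lam * p - q) <= lam * s - z by lra.
have := ler_wpM2l (ltW (mulr_gt0 (ltr0n R 2) l0)) h3.
rewrite (_ : 2 * lam * (t * (lam * p - q)) = 2 * (t * lam) * (lam * p - q)); last by ring.
by rewrite tl; lra.
Qed.

(** * Exterior products and closeness of near maximizers *)

Definition wedge u v (z : T * T) : R := u z.1 * v z.2 - v z.1 * u z.2.

Lemma sqi_wedge u v : sqi mu u -> sqi mu v -> sqi m2 (wedge u v).
Proof.
move=> su sv; apply: (@sqiB _ _ _ _ (fun z : T * T => u z.1 * v z.2)
  (fun z : T * T => v z.1 * u z.2)); exact: sqi_tensor.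
Qed.

Lemma ip_wedge u v p q : sqi mu u -> sqi mu v -> sqi mu p -> sqi mu q ->
  ip m2 (wedge u v) (wedge p q) =
  2 * (ip mu u p * ip mu v q - ip mu u q * ip mu v p).
Proof.
move=> su sv sp sq.
have st f g : sqi mu f -> sqi mu g -> sqi m2 (fun z : T * T => f z.1 * g z.2).
  exact: sqi_tensor.
have h f g : sqi mu f -> sqi mu g ->
    ip m2 (fun z => f z.1 * g z.2) (wedge p q) =
    ip mu f p * ip mu g q - ip mu f q * ip mu g p.
  move=> sf sg; rewrite ipC.
  rewrite (ipBl (u := fun z : T * T => p z.1 * q z.2)
                (v := fun z : T * T => q z.1 * p z.2)); [|exact: st..].
  rewrite !ip_tensor//.
  by rewrite (ipC _ p f) (ipC _ q g) (ipC _ q f) (ipC _ p g).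
rewrite (ipBl (u := fun z : T * T => u z.1 * v z.2)
              (v := fun z : T * T => v z.1 * u z.2)); last first.
- exact: sqi_wedge.
- exact: st.
- exact: st.
by rewrite !h//; ring.
Qed.

(** A Gram determinant for the form: a small wedge forces near equality in the Cauchy-Schwarz
    inequality of the form. *)
Lemma form_wedge u v : sqi mu u -> sqi mu v ->
  form u u * form v v - form u v ^+ 2 =
  2^-1 * ip m2 (wedge u v) (wedge (opT u) (opT v)).
Proof.
move=> su sv; have sTu := sqi_opT su; have sTv := sqi_opT sv.
rewrite ip_wedge// (ipC _ u (opT u)) (ipC _ v (opT u)) (ipC _ u (opT v)).
by rewrite (ipC _ v (opT v)) -!form_opT// (form_sym sv su); field.
Qed.

(** With [P = x x' + y y'], Lagrange's identity reads [S^2 = P^2 + (x y' - y x')^2]. Hence the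
    square of the wedge is [(S - P)(S + P) <= 2 S (S - P)], and the inequality of means with
    parameter [th] separates the two factors. *)
Lemma wedge_pointwise (x x' y y' th : R) : 0 <= x -> 0 <= x' -> 0 <= y -> 0 <= y' ->
  0 < th ->
  let S := Num.sqrt (x ^+ 2 + y ^+ 2) * Num.sqrt (x' ^+ 2 + y' ^+ 2) in
  `|x * y' - y * x'| <= th^-1 * (S - x * x' - y * y') + th / 2 * S.
Proof.
move=> x0 x'0 y0 y'0 th0; set S := (X in let _ := X in _); cbv zeta.
have S0 : 0 <= S by rewrite mulr_ge0 ?sqrtr_ge0.
have S2 : S ^+ 2 = (x * x' + y * y') ^+ 2 + (x * y' - y * x') ^+ 2.
  by rewrite exprMn !sqr_sqrtr ?addr_ge0 ?sqr_ge0//; ring.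
set P := x * x' + y * y' in S2.
have P0 : 0 <= P by rewrite addr_ge0 ?mulr_ge0.
have PS : P <= S by rewrite -(@ler_pXn2r _ 2%N) ?nnegrE// S2 lerDl sqr_ge0.
have -> : S - x * x' - y * y' = S - P by rewrite /P; ring.
have A0 : 0 <= th^-1 * (S - P) by rewrite mulr_ge0 ?invr_ge0 ?(ltW th0)// subr_ge0.
have B0 : 0 <= th / 2 * S by rewrite mulr_ge0// divr_ge0// ltW.
rewrite -(@ler_pXn2r _ 2%N) ?nnegrE ?addr_ge0// real_normK ?num_real//.
have -> : (x * y' - y * x') ^+ 2 = (S - P) * (S + P) by rewrite -subr_sqr S2; ring.
apply: (@le_trans _ _ (4 * (th^-1 * (S - P)) * (th / 2 * S))).
  have -> : 4 * (th^-1 * (S - P)) * (th / 2 * S) = (S - P) * (S + S).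
    by field; exact: lt0r_neq0.
  by rewrite ler_wpM2l ?subr_ge0// lerD2l.
by have := sqr_ge0 (th^-1 * (S - P) - th / 2 * S); lra.
Qed.

Lemma itg_wedge_ker u v : sqi mu u -> sqi mu v ->
  itg m2 (fun z => `|wedge u v z| * ker z).
Proof.
move=> su sv; apply: itgM; last exact: sqi_ker.
exact: (sqi_norm (sqi_wedge su sv)).
Qed.

(* [form s s <= 2 * lam] for [s = sqrt (u^2 + v^2)], and pointwise
   [s s' - u u' - v v'] controls the square of the wedge. *)
Lemma wedge_ker_le u v th : normalized u -> normalized v ->
  (forall x, 0 <= u x) -> (forall x, 0 <= v x) -> 0 < th ->
  \int[m2]_z (`|wedge u v z| * ker z) <=
  th^-1 * (2 * lam - form u u - form v v) + th * lam.
Proof.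
move=> [su u1] [sv v1] u0 v0 th0.
pose s x := Num.sqrt (u x ^+ 2 + v x ^+ 2).
have s2 x : s x * s x = u x ^+ 2 + v x ^+ 2.
  by rewrite -expr2 sqr_sqrtr// addr_ge0 ?sqr_ge0.
have ss : sqi mu s.
  apply: (sqi_le _ (sqiD (sqi_norm su) (sqi_norm sv))).
    have msq : measurable_fun setT (@Num.sqrt R).
      by apply: continuous_measurable_fun => x; exact: sqrt_continuous.
    apply: (measurableT_comp msq); apply: measurable_funD.
      exact/measurable_funX/(sqi_measurable su).
    exact/measurable_funX/(sqi_measurable sv).
  move=> x; rewrite (ger0_norm (u0 x)) (ger0_norm (v0 x)).
  rewrite !ger0_norm ?sqrtr_ge0 ?addr_ge0//.
  rewrite -(@ler_pXn2r _ 2%N) ?nnegrE ?sqrtr_ge0 ?addr_ge0// expr2 s2.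
  by have := mulr_ge0 (u0 x) (v0 x); lra.
have ip_s : ip mu s s = 2.
  rewrite /ip (eq_Int _ s2) IntD; [|exact: (sqi_proj su)|exact: (sqi_proj sv)].
  have e w : \int[mu]_x (w x ^+ 2) = ip mu w w by apply: eq_Int => x; rewrite expr2.
  by rewrite !e u1 v1.
have fs := form_le_lam ss; rewrite ip_s in fs.
have iu := itg_form su su; have iv := itg_form sv sv; have is_ := itg_form ss ss.
have i2 : itg m2 (fun z => s z.1 * s z.2 * ker z - u z.1 * u z.2 * ker z - v z.1 * v z.2 * ker z).
  exact: (itgB (itgB is_ iu) iv).
apply: (@le_trans _ _ (\int[m2]_z (th^-1 *
   (s z.1 * s z.2 * ker z - u z.1 * u z.2 * ker z - v z.1 * v z.2 * ker z) +
   th / 2 * (s z.1 * s z.2 * ker z)))).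
  apply: le_Int => [||z].
  - exact: itg_wedge_ker.
  - exact: (itgD (itgZ _ i2) (itgZ _ is_)).
  - have := wedge_pointwise (u0 z.1) (u0 z.2) (v0 z.1) (v0 z.2) th0.
    move=> /(ler_wpM2r (ltW (ker_gt0 z))) /le_trans; apply.
    by rewrite le_eqVlt; apply/orP; left; apply/eqP; rewrite -/(s z.1) -/(s z.2); ring.
rewrite (IntD (itgZ _ i2) (itgZ _ is_)) !IntZ// (IntB (itgB is_ iu) iv) IntB//.
rewrite -/(form s s) -/(form u u) -/(form v v).
apply: lerD.
  by apply: ler_wpM2l; [rewrite invr_ge0 ltW|lra].
by move: fs; rewrite -(@ler_pM2l _ (th / 2)) ?divr_gt0//; lra.
Qed.

(** Vanishes once [n * k z >= 1], and satisfies [1 <= n * k + cut n]: this splits the weight into a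
    multiple of the kernel and a remainder supported where the link is below [1 / n]. *)
Let cut (n : nat) z : R := Num.max 0 (1 - n%:R * k z).
Let cutK n z : R := a z.1 * a z.2 * cut n z.

Let cut_ge0 n z : 0 <= cut n z. Proof. by rewrite le_max lexx. Qed.

Let cut_le1 n z : cut n z <= 1.
Proof.
by rewrite ge_max ler01 lerBlDr lerDl mulr_ge0// ltW.
Qed.

Let cutK_le n z : `|cutK n z| <= `|a z.1 * a z.2|.
Proof.
rewrite normrM (ger0_norm (cut_ge0 n z)) ler_piMr//; exact: cut_le1.
Qed.

Let sqi_cutK n : sqi m2 (cutK n).
Proof.
apply: (sqi_le _ (sqi_tensor sqi_a sqi_a)); last exact: cutK_le.
apply: measurable_funM; first exact: measurable_tensor.
apply: measurable_maxr; first exact: measurable_cst.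
by apply: measurable_funB => //; exact: measurable_funM.
Qed.

Let cutK_cvg0 : (fun n => ip m2 (cutK n) (cutK n)) @ \oo --> 0.
Proof.
have saa := sqi_tensor sqi_a sqi_a.
rewrite (_ : 0 = fine (\int[m2]_z (cst 0 z : \bar R))%E); last first.
  by rewrite integral0.
apply: fine_cvg; rewrite fineK; last by rewrite integral0.
apply: (@dominated_cvg _ _ _ m2 setT measurableT
  (fun n z => (cutK n z * cutK n z)%:E) (cst 0%E)
  (fun z => ((a z.1 * a z.2) * (a z.1 * a z.2))%:E)).
- by move=> n; apply/measurable_EFinP; apply: measurable_funM; case: (sqi_cutK n).
- move=> z _; apply: cvg_near_cst.
  (* Since [k z] is positive, the cut-off at [z] is zero for every [n] beyond [1 / k z]. *)
  exists (Num.truncn (k z)^-1).+1 => // n /= nk.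
  suff cut0 : cut n z = 0 by rewrite /cutK cut0 !mulr0.
  apply/max_idPl; rewrite subr_le0.
  rewrite -ler_pdivrMr// div1r (le_trans (ltW (truncnS_gt _)))//.
  by rewrite ler_nat.
- by [].
- exact: (itgM saa saa).
- move=> n z _; rewrite lee_fin normrM.
  have := cutK_le n z; rewrite (ger0_norm (mulr_ge0 (ltW (a_gt0 z.1)) (ltW (a_gt0 z.2)))).
  by move=> h; apply: ler_pM.
Qed.

Let opT_norm_le u y : normalized u -> `|opT u y| <= Num.sqrt M2 * a y.
Proof.
move=> [su u1]; rewrite -(@ler_pXn2r _ 2%N) ?nnegrE//; last first.
  by rewrite mulr_ge0 ?sqrtr_ge0// ltW.
rewrite real_normK ?num_real// exprMn sqr_sqrtr ?(ltW M2_gt0)//.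
by have := opT_sqr_le y su; rewrite u1 mulr1.
Qed.

(* The left-hand side is the pairing of [wedge u v] with the wedge of [T u] and
   [T v], which is [O(a a')].  Where the link is at least of order [1 / n] the
   weight [a a'] is dominated by [n * ker]; elsewhere it is small in [L^2]. *)
Let gap_ineq n th s u v : normalized u -> normalized v ->
  (forall x, 0 <= u x) -> (forall x, 0 <= v x) -> 0 < th -> 0 < s ->
  form u u * form v v - form u v ^+ 2 <=
  M2 * (n%:R * (th^-1 * (2 * lam - form u u - form v v) + th * lam) +
        s / 2 * ip m2 (cutK n) (cutK n) + s^-1).
Proof.
move=> nu nv u0 v0 th0 s0; have [su u1] := nu; have [sv v1] := nv.
have sTu := sqi_opT su; have sTv := sqi_opT sv.
have sw := sqi_wedge su sv; have sW := sqi_wedge sTu sTv.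
rewrite form_wedge// -IntZ; last exact: itgM.
have iw := itg_wedge_ker su sv.
have ic := itgM (sqi_cutK n) (sqi_cutK n).
have iww := itgM sw sw.
have ww : ip m2 (wedge u v) (wedge u v) <= 2.
  by rewrite ip_wedge// u1 v1 (ipC _ v u); have := sqr_ge0 (ip mu u v); lra.
have i1 := itgD (itgD (itgZ n%:R iw) (itgZ (s / 2) ic)) (itgZ (s^-1 / 2) iww).
apply: (@le_trans _ _ (\int[m2]_z (M2 * (n%:R * (`|wedge u v z| * ker z) +
   s / 2 * (cutK n z * cutK n z) + s^-1 / 2 * (wedge u v z * wedge u v z))))).
  apply: le_Int => [||z].
  - by apply: itgZ; exact: itgM.
  - exact: (itgZ M2 i1).
  set w := wedge u v z; set W := wedge _ _ z.
  have aa0 : 0 < a z.1 * a z.2 by rewrite mulr_gt0.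
  (* The factor 2, from the two terms of the wedge, cancels the 1/2 of [form_wedge]. *)
  have W_le : `|W| <= 2 * M2 * (a z.1 * a z.2).
    have h f g : normalized f -> normalized g ->
        `|opT f z.1 * opT g z.2| <= M2 * (a z.1 * a z.2).
      move=> nf ng; rewrite normrM.
      apply: (le_trans (ler_pM (normr_ge0 _) (normr_ge0 _) (opT_norm_le z.1 nf) (opT_norm_le z.2 ng))).
      have -> : Num.sqrt M2 * a z.1 * (Num.sqrt M2 * a z.2) =
        Num.sqrt M2 ^+ 2 * (a z.1 * a z.2) by ring.
      by rewrite sqr_sqrtr// ltW.
    apply: (le_trans (ler_normB _ _)).
    by have := h _ _ nu nv; have := h _ _ nv nu; lra.
  apply: (@le_trans _ _ (M2 * (`|w| * (a z.1 * a z.2)))).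
    apply: (le_trans (ler_norm _)); rewrite normrM normrM ger0_norm ?invr_ge0//.
    have := ler_wpM2l (normr_ge0 w) W_le; lra.
  rewrite ler_pM2l//.
  have one : 1 <= n%:R * k z + cut n z.
    by rewrite -lerBlDl le_max lexx orbT.
  apply: (@le_trans _ _ (n%:R * (`|w| * ker z) + `|w| * cutK n z)).
    have := ler_wpM2l (mulr_ge0 (normr_ge0 w) (ltW aa0)) one.
    by rewrite /cutK /ker; lra.
  rewrite -addrA lerD2l.
  have -> : w * w = `|w| * `|w| by rewrite -!expr2 real_normK// num_real.
  (* Weighted inequality of means: [|w| cutK <= (s / 2) cutK^2 + |w|^2 / (2 s)]. *)
  have := mulr_ge0 (ltW s0) (sqr_ge0 (cutK n z - s^-1 * `|w|)).
  have -> : s * (cutK n z - s^-1 * `|w|) ^+ 2 = s * cutK n z ^+ 2 -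
     2 * (`|w| * cutK n z) + s^-1 * (`|w| * `|w|) by field; exact: lt0r_neq0.
  by lra.
rewrite (IntZ _ i1) ler_pM2l//.
rewrite (IntD (itgD (itgZ n%:R iw) (itgZ (s / 2) ic)) (itgZ (s^-1 / 2) iww)).
rewrite (IntD (itgZ n%:R iw) (itgZ (s / 2) ic)) !IntZ//.
apply: lerD; last first.
  have : 0 < s^-1 by rewrite invr_gt0.
  by rewrite -/(ip m2 (wedge u v) (wedge u v)) => s1; nra.
rewrite lerD2r; apply: ler_wpM2l => //.
exact: wedge_ker_le.
Qed.

(** A small Gram determinant puts [form u v] near [lam]; comparing the form of [u + v] with
    [lam * |u + v|^2] then bounds [|u - v|^2]. Nonnegativity rules out pairs such as [u] and
    [- u]. *)
Lemma near_maximizers_close e : 0 < e -> exists2 de, 0 < de &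
  forall u v, normalized u -> normalized v ->
    (forall x, 0 <= u x) -> (forall x, 0 <= v x) ->
    lam - de <= form u u -> lam - de <= form v v ->
    ip mu (fun x => u x - v x) (fun x => u x - v x) <= e.
Proof.
move=> e0; have l0 := lam_gt0.
(* The target for the Gram determinant is [lam * e1 / 2 = M2 * Q], and each of the four terms in
   [gap_ineq] is given [Q / 4]: [s] settles the last one, then [n] the cut-off, then [th], and
   finally [de]. As [n] may be 0, [m = n + 1] is used in denominators. *)
pose e1 := e * lam / 4; have e10 : 0 < e1 by rewrite divr_gt0// mulr_gt0.
pose Q := lam * e1 / (2 * M2).
have Q0 : 0 < Q by rewrite divr_gt0 ?mulr_gt0.
pose s := 4 / Q; have s0 : 0 < s by rewrite divr_gt0.
have [n Jn] : exists n, s / 2 * ip m2 (cutK n) (cutK n) <= Q / 4.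
  have Qs : 0 < Q / 4 / (s / 2) by apply: divr_gt0; exact: divr_gt0.
  have /cvgrPdist_le /(_ _ Qs) [n _ /(_ n (leqnn n))] := cutK_cvg0.
  rewrite sub0r normrN ger0_norm ?ip_ge0// ler_pdivlMr; last exact: divr_gt0.
  move=> h.
  by exists n; rewrite mulrC.
pose m : R := n%:R + 1; have m0 : 0 < m by rewrite ltr_wpDl.
pose th := Q / (4 * m * lam); have th0 : 0 < th by rewrite divr_gt0// !mulr_gt0.
pose de := Num.min (e1 / 8) (Q * th / (8 * m)).
have de0 : 0 < de by rewrite lt_min; apply/andP; split; apply: divr_gt0 => //; exact: mulr_gt0.
have de1 : de <= e1 / 8 by rewrite ge_min lexx.
have de2 : de <= Q * th / (8 * m) by rewrite ge_min lexx orbT.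
exists de => // u v nu nv u0 v0 lu lv.
have [su u1] := nu; have [sv v1] := nv.
have := gap_ineq n nu nv u0 v0 th0 s0.
set D := (X in X <= _) => hD.
have hD2 : D <= lam * e1 / 2.
  apply: (le_trans hD).
  have -> : lam * e1 / 2 = M2 * Q by rewrite /Q; field; exact: lt0r_neq0.
  rewrite ler_pM2l//.
  have s1 : s^-1 = Q / 4 by rewrite /s invf_div.
  have t1 : n%:R * (th * lam) <= Q / 4.
    have -> : Q / 4 = m * (th * lam).
      by rewrite /th; field; rewrite !lt0r_neq0.
    by apply: ler_wpM2r; [apply: mulr_ge0; exact: ltW|rewrite /m lerDl].
  have t2 : n%:R * (th^-1 * (2 * lam - form u u - form v v)) <= Q / 4.
    have -> : Q / 4 = m * (th^-1 * (2 * (Q * th / (8 * m)))).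
      by field; rewrite !lt0r_neq0.
    have th1 : 0 <= th^-1 by rewrite invr_ge0 ltW.
    have q0 : 0 <= 2 * lam - form u u - form v v.
      have := form_le_lam su; have := form_le_lam sv; rewrite u1 v1; lra.
    apply: ler_pM => //; first exact: mulr_ge0.
      by rewrite /m lerDl.
    by apply: ler_wpM2l => //; lra.
  by rewrite s1 mulrDr; lra.
have uv0 := form_ge0 u0 v0.
(* Otherwise the determinant would be at least [(lam - de)^2 - lam * (lam - e1)], which exceeds
   [lam * e1 / 2] because [de <= e1 / 8]. *)
have fuv : lam - e1 <= form u v.
  rewrite leNgt; apply/negP => lt.
  have : form u v ^+ 2 <= lam * (lam - e1).
    rewrite expr2; apply: ler_pM => //; last exact: ltW.
    by apply: ltW; apply: (lt_trans lt); rewrite gtrBl.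
  have : (lam - de) ^+ 2 <= form u u * form v v.
    have : 0 <= lam - de.
      have : 0 <= lam - e1 by exact: (le_trans uv0 (ltW lt)).
      by lra.
    by move=> ld; rewrite expr2; apply: ler_pM.
  have : lam * de <= lam * (e1 / 8) by rewrite ler_pM2l.
  by have := sqr_ge0 de; move: hD2; rewrite /D; have := mulr_gt0 l0 e10; lra.
have := form_le_lam (sqiD su sv).
rewrite form_sqrD// ip_sqrD// ip_sqrB// u1 v1.
have -> : e = 4 * e1 / lam by rewrite /e1; field; exact: lt0r_neq0.
by move=> h; rewrite ler_pdivlMr//; lra.
Qed.

Lemma opT_bound u y : sqi mu u -> `|opT u y| <= Num.sqrt (M2 * ip mu u u) * a y.
Proof.
move=> su; rewrite -(@ler_pXn2r _ 2%N) ?nnegrE//; last first.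
  by rewrite mulr_ge0 ?sqrtr_ge0// ltW.
rewrite real_normK ?num_real// exprMn sqr_sqrtr; first exact: opT_sqr_le.
by rewrite mulr_ge0 ?ip_ge0// ltW.
Qed.

Lemma maximizer_eigen u : normalized u -> form u u = lam ->
  {ae mu, forall x, opT u x = lam * u x}.
Proof.
move=> [su u1] ful; have := resid_le su; rewrite u1 ful mulr1 subrr mulr0 => r0.
have sr := sqiB (sqiZ lam su) (sqi_opT su).
have /(ip_eq0 sr) : ip mu (fun x => lam * u x - opT u x) (fun x => lam * u x - opT u x) = 0.
  by apply/eqP; rewrite eq_le r0 ip_ge0.
by apply: filterS => x /eqP; rewrite subr_eq0 => /eqP.
Qed.

Lemma opT_gt0 u y : sqi mu u -> (forall x, 0 <= u x) -> 0 < ip mu u u -> 0 < opT u y.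
Proof.
move=> su u0 u1; have h x : 0 <= u x * ker (x, y) by rewrite mulr_ge0// ltW// ker_gt0.
rewrite lt_neqAle Int_ge0// andbT; apply/eqP => /esym /(Int_eq0 (itg_ker2 y su) h) ae0.
move: u1; rewrite /ip (@ae_eq_Int _ _ _ _ _ (cst 0)).
- by rewrite Rintegral_cst// mul0r ltxx.
- exact: (measurable_funM (sqi_measurable su) (sqi_measurable su)).
- exact: measurable_cst.
- apply: filterS ae0 => x /= /eqP; rewrite mulf_eq0 (gt_eqF (ker_gt0 _)) orbF.
  by move=> /eqP ->; rewrite mul0r.
Qed.

Lemma eigenvalue_le_lam u m : sqi mu u -> 0 < ip mu u u ->
  {ae mu, forall x, opT u x = m * u x} -> m <= lam.
Proof.
move=> su u0 eu; have := form_le_lam su.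
rewrite form_opT// /ip (@ae_eq_Int _ _ _ _ _ (fun x => m * (u x * u x))).
- by rewrite IntZ ?ler_pM2r//; exact: itgM.
- exact: (measurable_funM (sqi_measurable (sqi_opT su)) (sqi_measurable su)).
- apply: measurable_funM => //.
  exact: (measurable_funM (sqi_measurable su) (sqi_measurable su)).
- by apply: filterS eu => x /= ->; rewrite mulrA.
Qed.

(** * Existence of a positive maximizer *)

Let defect u := lam * ip mu u u - form u u.

(** Parallelogram law for [defect], with the nonnegative defect of [u - v] dropped. *)
Let defectD u v : sqi mu u -> sqi mu v ->
  defect (fun x => u x + v x) <= 2 * defect u + 2 * defect v.
Proof.
move=> su sv; have := form_le_lam (sqiB su sv).
by rewrite /defect form_sqrB// ip_sqrB// form_sqrD// ip_sqrD//; lra.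
Qed.

Let opT_cauchy (u : nat -> T -> R) : (forall n, sqi mu (u n)) ->
  (forall e, 0 < e -> exists m, forall n, (m <= n)%N ->
     ip mu (fun x => u n x - u m x) (fun x => u n x - u m x) <= e) ->
  forall y, cvgn (fun n => opT (u n) y).
Proof.
move=> su uC y; apply/cauchy_cvgP/cauchy_exP => e e0.
have b0 : 0 < e ^+ 2 / (4 * M2 * a y ^+ 2).
  by rewrite divr_gt0 ?exprn_gt0// !mulr_gt0// exprn_gt0.
have [m um] := uC _ b0; exists (opT (u m) y); exists m => // n /= mn.
rewrite /ball/= distrC -opTB//.
have := opT_sqr_le y (sqiB (su n) (su m)) => h.
rewrite -(@ltr_pXn2r _ 2%N) ?nnegrE// ?(ltW e0)// real_normK ?num_real//.
apply: (le_lt_trans h).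
have := ler_wpM2r (sqr_ge0 (a y)) (ler_wpM2l (ltW M2_gt0) (um n mn)) => /le_lt_trans; apply.
have -> : M2 * (e ^+ 2 / (4 * M2 * a y ^+ 2)) * a y ^+ 2 = e ^+ 2 / 4.
  by field; rewrite !lt0r_neq0.
by have : 0 < e ^+ 2 by [rewrite exprn_gt0]; lra.
Qed.

(** Stands in for completeness of L^2: for a Cauchy sequence the images [T (u n)] converge at every
    point, uniformly relative to the weight [a], so the limit is square-integrable by comparison
    with [a]. *)
Let opT_lim (u : nat -> T -> R) : (forall n, sqi mu (u n)) ->
  (forall e, 0 < e -> exists m, forall n, (m <= n)%N ->
     ip mu (fun x => u n x - u m x) (fun x => u n x - u m x) <= e) ->
  exists t, [/\ sqi mu t, (forall y, (fun n => opT (u n) y) @ \oo --> t y) &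
    forall e, 0 < e -> exists m, forall n, (m <= n)%N ->
     ip mu (fun x => t x - opT (u n) x) (fun x => t x - opT (u n) x) <= e].
Proof.
move=> su uC; have tC := opT_cauchy su uC.
pose t y := limn (fun n => opT (u n) y).
have tE y : (fun n => opT (u n) y) @ \oo --> t y by exact: tC.
have mt : measurable_fun setT t.
  apply: (@measurable_fun_cvg _ _ _ setT (fun n => opT (u n))) => // n.
  exact: (sqi_measurable (sqi_opT (su n))).
have td e : 0 < e -> exists m, forall n, (m <= n)%N -> forall y,
    `|t y - opT (u n) y| <= Num.sqrt (M2 * e) * a y.
  (* Passing from [u i] to [u n] through [u m] costs [2 * (e / 4) + 2 * (e / 4) = e]. *)
  move=> e0; have e40 : 0 < e / 4 by rewrite divr_gt0.
  have [m um] := uC _ e40; exists m => n mn y.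
  have di i : (m <= i)%N -> `|opT (u i) y - opT (u n) y| <= Num.sqrt (M2 * e) * a y.
    move=> mi; rewrite -opTB//; apply: (le_trans (opT_bound y (sqiB (su i) (su n)))).
    rewrite ler_pM2r// ler_wsqrtr// ler_pM2l//.
    have -> : (fun x => u i x - u n x) = (fun x => (u i x - u m x) + (-1) * (u n x - u m x)).
      by apply/funext => x; ring.
    have sd j : sqi mu (fun x => u j x - u m x) by exact: sqiB.
    apply: (le_trans (ip_sqrD_le (sd i) (sqiZ (-1) (sd n)))).
    by rewrite ip_sqrZ//; have := um _ mi; have := um _ mn; lra.
  have c : (fun i => `|opT (u i) y - opT (u n) y|) @ \oo --> `|t y - opT (u n) y|.
    by apply: cvg_norm; apply: cvgB; [exact: tE|exact: cvg_cst].
  rewrite -(cvg_lim _ c)//; apply: limr_le; first by apply/cvg_ex; eexists; exact: c.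
  by exists m.
have st : sqi mu t.
  have [m /(_ m (leqnn m)) tm] := td 1 ltr01.
  have -> : t = (fun x => (t x - opT (u m) x) + opT (u m) x).
    by apply/funext => x; rewrite subrK.
  apply: sqiD; last exact: sqi_opT.
  apply: (sqi_le _ (sqiZ (Num.sqrt (M2 * 1)) sqi_a)).
    exact: (measurable_funB mt (sqi_measurable (sqi_opT (su m)))).
  by move=> x; apply: (le_trans (tm x)); exact: ler_norm.
exists t; split => // e e0.
have e'0 : 0 < e / (M2 * N) by rewrite divr_gt0// mulr_gt0.
have [m tm] := td _ e'0; exists m => n mn.
apply: (@le_trans _ _ (ip mu (fun x => Num.sqrt (M2 * (e / (M2 * N))) * a x)
   (fun x => Num.sqrt (M2 * (e / (M2 * N))) * a x))).
  apply: le_Int => [||x].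
  - by apply: itgM; apply: sqiB => //; exact: sqi_opT.
  - by apply: itgM; exact: sqiZ.
  - by rewrite -!expr2 -[leLHS]real_normK ?num_real// lerXn2r ?nnegrE ?(le_trans _ (tm n mn x)) ?tm.
rewrite ip_sqrZ// sqr_sqrtr; last by rewrite mulr_ge0 ?(ltW M2_gt0)// ltW.
by rewrite -/N le_eqVlt; apply/orP; left; apply/eqP; field; rewrite !lt0r_neq0.
Qed.

Lemma exists_maximizer : exists u, [/\ normalized u, form u u = lam &
  {ae mu, forall x, 0 < u x}].
Proof.
have l0 := lam_gt0.
have inv0 n : 0 < (n.+1%:R : R)^-1 by rewrite invr_gt0.
have [u uP] := choice (fun n => lam_adherent (inv0 n)).
have nu n : normalized (u n) by case: (uP n).
have su n : sqi mu (u n) by case: (nu n).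
have u0 n x : 0 <= u n x by case: (uP n).
have near_max e : 0 < e -> exists m, forall n, (m <= n)%N -> lam - e <= form (u n) (u n).
  move=> e0; exists (Num.truncn e^-1).+1 => n mn.
  have [_ _ /ltW] := uP n; apply: le_trans; rewrite lerD2l lerN2.
  rewrite invf_ple ?posrE//; apply: (le_trans (ltW (truncnS_gt _))).
  by rewrite ler_nat (leq_trans mn).
have uC e : 0 < e -> exists m, forall n, (m <= n)%N ->
     ip mu (fun x => u n x - u m x) (fun x => u n x - u m x) <= e.
  move=> e0; have [de de0 gap] := near_maximizers_close e0; have [m um] := near_max _ de0.
  by exists m => n mn; apply: gap => //; apply: um.
have [t [st tE tC]] := opT_lim su uC.
have t0 x : 0 <= t x.
  rewrite -(cvg_lim _ (tE x))//; apply: limr_ge; first by apply/cvg_ex; eexists; exact: tE.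
  by apply: nearW => n; apply: Int_ge0 => z; rewrite mulr_ge0// ltW// ker_gt0.
(* The limit [t] of [T (u n)] is also close to [lam * u n], since near maximizers almost solve the
   eigenvalue equation ([resid_le]). *)
have approx e : 0 < e -> exists n,
    ip mu (fun x => t x - lam * u n x) (fun x => t x - lam * u n x) <= e /\
    lam - form (u n) (u n) <= e.
  move=> e0; have e1 : 0 < e / 4 by rewrite divr_gt0.
  have e2 : 0 < Num.min e (e / (8 * lam)) by rewrite lt_min e0 divr_gt0// mulr_gt0.
  have [m1 tm] := tC _ e1; have [m2 um] := near_max _ e2.
  pose n := maxn m1 m2; exists n.
  have := um n (leq_maxr _ _); have := tm n (leq_maxl _ _).
  set de := Num.min _ _; move=> h1 h2.
  have de1 : de <= e by rewrite ge_min lexx.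
  have de2 : de <= e / (8 * lam) by rewrite ge_min lexx orbT.
  split; last by lra.
  have -> : (fun x => t x - lam * u n x) =
     (fun x => (t x - opT (u n) x) + (-1) * (lam * u n x - opT (u n) x)).
    by apply/funext => x; ring.
  have s1 : sqi mu (fun x => t x - opT (u n) x) by apply: sqiB => //; exact: sqi_opT.
  have s2 : sqi mu (fun x => lam * u n x - opT (u n) x).
    by apply: sqiB; [exact: sqiZ|exact: sqi_opT].
  apply: (le_trans (ip_sqrD_le s1 (sqiZ (-1) s2))); rewrite ip_sqrZ//.
  have := resid_le (su n); rewrite (nu n).2 mulr1 => h3.
  have h4 : 2 * lam * (lam - form (u n) (u n)) <= e / 4.
    have -> : e / 4 = 2 * lam * (e / (8 * lam)) by field; exact: lt0r_neq0.
    by rewrite ler_pM2l ?mulr_gt0//; lra.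
  by lra.
have dt : defect t = 0.
  apply/eqP; rewrite eq_le subr_ge0 form_le_lam// andbT.
  rewrite leNgt; apply/negP => dpos.
  (* At this accuracy [c], [defectD] gives [defect t <= (2 lam^2 + 4 lam) c], which is half of
     [defect t]. *)
  have c0 : 0 < defect t / (4 * (lam ^+ 2 + 2 * lam)).
    by rewrite divr_gt0// mulr_gt0// addr_gt0 ?exprn_gt0 ?mulr_gt0.
  have [n [h1 h2]] := approx _ c0.
  have sl := sqiZ lam (su n); have sr := sqiB st sl.
  have := defectD sl sr.
  have -> : (fun x => lam * u n x + (t x - lam * u n x)) = t.
    by apply/funext => x; rewrite addrC subrK.
  rewrite {2 3}/defect form_sqrZ// ip_sqrZ// (nu n).2 mulr1.
  have := form_ge_lam sr.
  set p := ip _ _ _ in h1 *; set q := form (fun x => t x - _) _.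
  set c := defect t / _ in h1 h2 c0.
  have -> : defect t = c * (4 * (lam ^+ 2 + 2 * lam)).
    by rewrite /c divfK// lt0r_neq0// mulr_gt0// addr_gt0 ?exprn_gt0 ?mulr_gt0.
  have : lam ^+ 2 * (lam - form (u n) (u n)) <= lam ^+ 2 * c.
    by rewrite ler_pM2l ?exprn_gt0.
  have : lam * p <= lam * c by rewrite ler_pM2l.
  have : 0 < lam ^+ 2 * c by rewrite mulr_gt0// exprn_gt0.
  have : 0 < lam * c by rewrite mulr_gt0.
  by lra.
have tt0 : 0 < ip mu t t.
  (* Since [|lam * u n|^2 = lam^2], this accuracy leaves [ip t t >= lam^2 / 4]. *)
  have c0 : 0 < lam ^+ 2 / 4 by rewrite divr_gt0// exprn_gt0.
  have [n [h1 _]] := approx _ c0.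
  have sl := sqiZ lam (su n); have sr := sqiB st sl.
  have := ip_sqrD_le st (sqiZ (-1) sr).
  have -> : (fun x => t x + -1 * (t x - lam * u n x)) = (fun x => lam * u n x).
    by apply/funext => x; ring.
  rewrite !ip_sqrZ// (nu n).2.
  have : 0 < lam ^+ 2 by rewrite exprn_gt0.
  by lra.
have nt := normalize st tt0.
set w := (fun x => _ * t x) in nt.
have fw : form w w = lam.
  rewrite form_sqrZ// exprVn sqr_sqrtr ?ip_ge0//.
  have -> : form t t = lam * ip mu t t by move/eqP: dt; rewrite subr_eq0 => /eqP.
  by rewrite mulrC mulfK// gt_eqF.
have w0 x : 0 <= w x by rewrite mulr_ge0// invr_ge0 sqrtr_ge0.
exists w; split => //.
(* The limit is only known to be nonnegative; the eigenvalue equation makes it positive, because [T]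
   maps nonzero nonnegative functions to positive ones. *)
apply: filterS (maximizer_eigen nt fw) => x /= ex.
have : 0 < opT w x by apply: opT_gt0 => //; [case: nt|case: nt => _ ->].
by rewrite ex pmulr_rgt0.
Qed.

Lemma ae_eq_opT u v y : sqi mu u -> sqi mu v ->
  {ae mu, forall x, u x = v x} -> opT u y = opT v y.
Proof.
move=> su sv uv; apply: ae_eq_Int.
- exact: (itg_measurable (itg_ker2 y su)).
- exact: (itg_measurable (itg_ker2 y sv)).
- by apply: filterS uv => x /= ->.
Qed.

Lemma ae_eq_ip u v p q : sqi mu u -> sqi mu v -> sqi mu p -> sqi mu q ->
  {ae mu, forall x, u x = p x} -> {ae mu, forall x, v x = q x} ->
  ip mu u v = ip mu p q.
Proof.
move=> su sv sp sq up vq; apply: ae_eq_Int.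
- exact: (measurable_funM (sqi_measurable su) (sqi_measurable sv)).
- exact: (measurable_funM (sqi_measurable sp) (sqi_measurable sq)).
- by apply: filterS2 up vq => x /= -> ->.
Qed.

(* [T u / lam] is the representative of the maximizer [u] for which the
   eigenvalue equation and positivity hold everywhere. *)
Lemma maximizer_regularize u : normalized u -> form u u = lam ->
  {ae mu, forall x, 0 < u x} ->
  let w := fun x => lam^-1 * opT u x in
  [/\ normalized w, forall x, 0 < w x, forall x, opT w x = lam * w x &
    {ae mu, forall x, u x = w x}].
Proof.
move=> nu fu u0 w; have [su u1] := nu; have l0 := lam_gt0.
have sw : sqi mu w by apply: sqiZ; exact: sqi_opT.
have uw : {ae mu, forall x, u x = w x}.
  apply: filterS (maximizer_eigen nu fu) => x ex.
  by rewrite /w ex mulKf// gt_eqF.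
have sn := sqi_norm su.
have un : {ae mu, forall x, u x = `|u x|}.
  by apply: filterS u0 => x ux; rewrite gtr0_norm.
split => //.
- by split => //; rewrite -u1; apply/esym; apply: ae_eq_ip.
- move=> x; rewrite /w (ae_eq_opT x su sn un) mulr_gt0 ?invr_gt0//.
  by apply: opT_gt0 => //; rewrite ip_norm u1.
- move=> x; rewrite -(ae_eq_opT x su sw uw) /w mulrA mulfV ?mul1r//.
  by rewrite gt_eqF.
Qed.
End PositiveKernel.
(** * The transfer operators of the model *)

Section LebesgueTranslation.
Context {R : realType}.
Local Notation mu := (@lebesgue_measure R).
Local Notation m2 := (mu \x mu)%E.

Lemma measurable_shift (y : R) : measurable_fun setT (fun x : R => x + y).
Proof. by apply: measurable_funD. Qed.

Lemma lebesgue_measure_shift (y : R) (A : set R) : measurable A ->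
  mu [set x | A (x + y)] = mu A.
Proof.
have h := measurable_shift y.
move=> mA; rewrite -[LHS]/(pushforward mu ((fun x => x + y) : R -> measurableTypeR R) A).
apply/esym/lebesgue_measure_unique => //= _ [[u v]] _ <-; rewrite /pushforward.
rewrite (_ : _ @^-1` _ = `]u - y, v - y]%classic); last first.
  by apply/seteqP; split => x /=; rewrite !in_itv /= ltrBlDr lerBrDr.
rewrite !lebesgue_measure_itv /= !lte_fin ltrD2r.
by case: ifP => // _; rewrite -!EFinB; congr (_%:E); ring.
Qed.

Lemma ae_shift (P : R -> Prop) (y : R) :
  {ae mu, forall x, P x} -> {ae mu, forall x, P (x + y)}.
Proof.
move=> [N [mN N0 NP]]; exists [set x | N (x + y)]; split.
- by rewrite -[X in measurable X]setTI; exact: measurable_shift.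
- by rewrite lebesgue_measure_shift.
- by move=> x /= nP; exact: NP.
Qed.

(** Each section of the exceptional set is a translate of a null set. *)
Lemma ae_sum (P : R -> Prop) :
  {ae mu, forall x, P x} -> {ae m2, forall z, P (z.1 + z.2)}.
Proof.
move=> [N [mN N0 NP]].
have mA : measurable [set z : R * R | N (z.1 + z.2)].
  rewrite -[X in measurable X]setTI; apply: (measurable_funD _ _) => //.
exists [set z : R * R | N (z.1 + z.2)]; split => //.
- rewrite /= /product_measure1 integral0_eq// => x _ /=.
  rewrite -[RHS]N0 -(lebesgue_measure_shift x mN); congr (mu _).
  by apply/seteqP; split => y; rewrite /xsection /= inE /= addrC.
- by move=> z /= nP; exact: NP.
Qed.

Lemma ae1_imp (P Q : R -> Prop) : (forall x, P x -> Q x) ->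
  {ae mu, forall x, P x} -> {ae mu, forall x, Q x}.
Proof. exact: (@ae_imp _ _ R mu P Q). Qed.

Lemma ae2_imp (P Q : R * R -> Prop) : (forall z, P z -> Q z) ->
  {ae m2, forall z, P z} -> {ae m2, forall z, Q z}.
Proof. exact: (@ae_imp _ _ R m2 P Q). Qed.

Lemma lebesgue_ae_exists (P : R -> Prop) (a b : R) : a < b ->
  {ae mu, forall x, P x} -> exists2 x, a < x <= b & P x.
Proof.
move=> ab [N [mN N0 NP]]; apply: contrapT => nex.
have : (mu `]a, b]%classic <= mu N)%E.
  apply: le_measure; rewrite ?inE//.
  move=> x /=; rewrite in_itv /= => xab; apply: NP => /= Px.
  by apply: nex; exists x.
rewrite N0 lebesgue_measure_itv /= lte_fin ab -EFinB lee_fin.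
by rewrite leNgt subr_gt0 ab.
Qed.

Lemma lebesgue_ae2_exists (P : R * R -> Prop) (a b : R) : a < b ->
  {ae m2, forall z, P z} ->
  exists z, [/\ a < z.1 <= b, a < z.2 <= b & P z].
Proof.
move=> ab [N [mN N0 NP]]; apply: contrapT => nex.
have : (m2 (`]a, b] `*` `]a, b]) <= m2 N)%E.
  apply: le_measure; rewrite ?inE//; first exact: measurableX.
  move=> x /=; rewrite !in_itv /= => -[x1 x2]; apply: NP => /= Px.
  by apply: nex; exists x.
have e := @lebesgue_measure_itv R `]a, b]; rewrite /= lte_fin ab -EFinB in e.
rewrite N0 product_measure1E//= e -EFinM lee_fin.
by rewrite leNgt mulr_gt0 ?subr_gt0// ab.
Qed.

End LebesgueTranslation.

Lemma maximum_eq (R : realType) (A : set R) m : A m -> ubound A m -> maximum A = m.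
Proof.
move=> Am uA; rewrite /maximum; case: xgetP => [x _ [Ax ux]|/(_ m)[]//].
by apply/eqP; rewrite eq_le uA// ux.
Qed.

Lemma le_sqrD1 (R : realDomainType) (x : R) : 0 <= x -> x <= (x + 1) ^+ 2.
Proof. by nra. Qed.

Lemma le_sqr_norm (R : realDomainType) (x y : R) : `|x| <= `|y| -> x * x <= y * y.
Proof.
move=> xy; have := ler_pM (normr_ge0 x) (normr_ge0 x) xy xy.
by rewrite -!expr2 !real_normK ?num_real.
Qed.

(** Integrability at every force amounts to exponential moments of all orders: changing the force
    multiplies the weight by an exponential. *)
Record admissible (R : realType) (beta : R) (W1 W2 : R -> R) (m : R) : Prop := Admissible {
  admissible_beta : 0 < beta ;
  admissible_mW1 : measurable_fun setT W1 ;
  admissible_mW2 : measurable_fun setT W2 ;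
  admissible_W2 : {ae @lebesgue_measure R, forall x, m <= W2 x} ;
  admissible_W1 : forall f, (@lebesgue_measure R).-integrable setT
    (EFin \o (fun x => expR (- beta * W1f W1 f x))) }.

Section Model.
Context {R : realType}.
Local Notation mu := (@lebesgue_measure R).
Local Notation m2 := (mu \x mu)%E.
Local Notation itg m f := ((m).-integrable setT (EFin \o f)).

Variables (beta : R) (W1 W2 : R -> R) (m : R).
Hypothesis hM : admissible beta W1 W2 m.

Let beta_gt0 := admissible_beta hM.
Let mW1 := admissible_mW1 hM.
Let mW2 := admissible_mW2 hM.
Let W2_ge := admissible_W2 hM.
Let W1_itg := admissible_W1 hM.

(* [W2] is only essentially bounded below; truncating it makes the kernel
   bounded everywhere and changes it on a null set only. *)
Definition boltz f x := expR (- beta / 2 * W1f W1 f x).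
Definition link (z : R * R) := expR (- beta * Num.max (W2 (z.1 + z.2)) m).

Lemma measurable_W1f f : measurable_fun setT (W1f W1 f).
Proof. by apply: measurable_funB => //; exact: measurable_funM. Qed.

Lemma measurable_boltz f : measurable_fun setT (boltz f).
Proof.
apply: (measurableT_comp (@measurable_expR R)).
by apply: measurable_funM => //; exact: measurable_W1f.
Qed.

Lemma boltz_sqr f x : boltz f x ^+ 2 = expR (- beta * W1f W1 f x).
Proof. by rewrite /boltz expr2 -expRD; congr expR; field. Qed.

Lemma sqi_boltz f : sqi mu (boltz f).
Proof.
split; first exact: measurable_boltz.
by rewrite (_ : (fun x => _) = fun x => expR (- beta * W1f W1 f x))//;
  apply/funext => x; exact: boltz_sqr.
Qed.

Lemma ip_gt0 u : sqi mu u -> (forall x, 0 < u x) -> 0 < ip mu u u.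
Proof.
move=> su u0; rewrite lt_neqAle ip_ge0 andbT; apply/eqP => /esym /(ip_eq0 su).
move=> /(lebesgue_ae_exists (ltr01)) [x _].
by move/eqP; rewrite gt_eqF.
Qed.

Lemma measurable_sumR (h : R -> R) : measurable_fun setT h ->
  measurable_fun setT (fun z : R * R => h (z.1 + z.2)).
Proof. by move=> mh; apply: (measurableT_comp mh); exact: measurable_funD. Qed.

Lemma bounded_kernel_boltz f :
  bounded_kernel mu (boltz f) link (expR (- beta * m)).
Proof.
split.
- by move=> x; exact: expR_gt0.
- exact: sqi_boltz.
- by apply: ip_gt0 => [|x]; [exact: sqi_boltz|exact: expR_gt0].
- apply: (measurable_sumR (h := fun x => expR (- beta * Num.max (W2 x) m))).
  apply: (measurableT_comp (@measurable_expR R)).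
  by apply: measurable_funM => //; exact: measurable_maxr.
- by move=> z; exact: expR_gt0.
- by move=> z; rewrite ler_expR !mulNr lerN2 ler_pM2l// le_max lexx orbT.
- by move=> x y; rewrite /link /= addrC.
Qed.

Let hK := bounded_kernel_boltz.

Lemma kernelE f x y : m <= W2 (x + y) ->
  K beta W1 W2 f x y = ker (boltz f) link (x, y).
Proof.
move=> mW; rewrite /K /ker /link /boltz /= max_l// -!expRD.
by congr expR; field.
Qed.

Lemma measurable_kernel f : measurable_fun setT (fun z : R * R => K beta W1 W2 f z.1 z.2).
Proof.
apply: (measurableT_comp (@measurable_expR R)).
have mW := measurable_W1f f.
have m1 : measurable_fun setT (fun z : R * R => W1f W1 f z.1).
  exact: (measurableT_comp mW measurable_fst).
have m2_ : measurable_fun setT (fun z : R * R => W1f W1 f z.2).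
  exact: (measurableT_comp mW measurable_snd).
apply: measurable_funB; last exact: measurable_funM.
apply: measurable_funB; last exact: measurable_funM.
by apply: measurable_funM => //; exact: measurable_sumR.
Qed.

Lemma energyE f u : sqi mu u ->
  energy beta W1 W2 f u = form mu (boltz f) link u u.
Proof.
move=> su; apply: ae_eq_Int.
- apply: measurable_funM; last exact: measurable_kernel.
  exact: (measurable_tensor (sqi_measurable su) (sqi_measurable su)).
- exact: (itg_measurable (itg_form (hK f) su su)).
- by apply: (ae2_imp _ (ae_sum W2_ge)) => -[x y] /= h; rewrite kernelE.
Qed.

Lemma unit_L2P u : unit_L2 u <-> normalized mu u.
Proof.
have e : ip mu u u = \int[mu]_x (u x ^+ 2) by apply: eq_Int => x; rewrite expr2.
by split=> -[/= /(sqi_Lfun mu u) su]; rewrite -?e ?e => u1; split => //; rewrite ?e.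
Qed.

Lemma lambdaE f : lambda beta W1 W2 f = lam mu (boltz f) link.
Proof.
have [u [nu fu _]] := exists_maximizer (hK f).
apply: maximum_eq.
  by exists u; [exact/unit_L2P|rewrite energyE//; case: nu].
move=> _ [v /unit_L2P [sv v1] <-]; rewrite energyE//.
by have := form_le_lam (hK f) sv; rewrite v1 mulr1.
Qed.

Lemma lambda_gt0 f : 0 < lambda beta W1 W2 f.
Proof. by rewrite lambdaE; exact: lam_gt0 (hK f). Qed.

Lemma K_shift xi x y :
  expR (xi * y / 2) * expR (xi * x / 2) * K beta W1 W2 0 x y =
  K beta W1 W2 (xi / beta) x y.
Proof.
by rewrite /K -!expRD; congr expR; rewrite /W1f; field; exact: lt0r_neq0.
Qed.

Lemma QbarE xi u y : sqi mu u ->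
  Qbar beta W1 W2 xi u y = opT mu (boltz (xi / beta)) link u y.
Proof.
move=> su.
have -> : Qbar beta W1 W2 xi u y = \int[mu]_x (u x * K beta W1 W2 (xi / beta) x y).
  by apply: eq_Int => x; rewrite -K_shift !mulrA.
apply: ae_eq_Int.
- apply: measurable_funM; first exact: sqi_measurable su.
  exact: (measurableT_comp (measurable_kernel (xi / beta)) (pair2_measurable y)).
- exact: (itg_measurable (itg_ker2 (hK (xi / beta)) y su)).
- by apply: (ae1_imp _ (ae_shift y W2_ge)) => x /= h; rewrite kernelE.
Qed.

(** A maximizer of the form is an eigenfunction for [lam], and pairing any eigenfunction with itself
    shows that its eigenvalue is at most [lam]. *)
Lemma LambdaE xi :
  Lambda beta W1 W2 xi = lambda beta W1 W2 (xi / beta) / lambda beta W1 W2 0.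
Proof.
congr (_ / _); rewrite lambdaE; apply: maximum_eq.
  have [u [nu fu _]] := exists_maximizer (hK (xi / beta)).
  have [su u1] := nu; exists u; split.
  - exact/(sqi_Lfun mu u).
  - move=> u0; have : ip mu u u = 0.
      rewrite /ip (@ae_eq_Int _ _ _ _ _ (cst 0)).
      + by rewrite Rintegral_cst// mul0r.
      + exact: (measurable_funM (sqi_measurable su) (sqi_measurable su)).
      + exact: measurable_cst.
      + by apply: (ae1_imp _ u0) => x /= ->; rewrite mul0r.
    by rewrite u1 => /eqP; rewrite oner_eq0.
  - apply: (ae1_imp _ (maximizer_eigen (hK (xi / beta)) nu fu)) => y.
    by rewrite QbarE.
move=> k [u [/(sqi_Lfun mu u) su u0 ek]].
apply: (eigenvalue_le_lam (hK (xi / beta)) su).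
  rewrite lt_neqAle ip_ge0 andbT; apply/eqP => /esym /(ip_eq0 su).
  exact: u0.
by apply: (ae1_imp _ ek) => y; rewrite QbarE.
Qed.

Definition ground f x : R :=
  (lambda beta W1 W2 f)^-1 * opT mu (boltz f) link (psi beta W1 W2 f) x.

Lemma groundP f : let w := ground f in
  [/\ normalized mu w, forall x, 0 < w x,
    forall x, opT mu (boltz f) link w x = lambda beta W1 W2 f * w x &
    {ae mu, forall x, psi beta W1 W2 f x = w x}].
Proof.
have [u [nu fu u0]] := exists_maximizer (hK f).
have [h1 h2 h3] : positive_maximizer beta W1 W2 f (psi beta W1 W2 f).
  (* The maximizer [u] excludes the default value of [psi]. *)
  rewrite /psi; case: xgetP => [v _//|/(_ u)]; case; split => //.
    exact/unit_L2P.
  by rewrite energyE ?lambdaE//; case: nu.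
have /unit_L2P np := h1.
rewrite /= /ground lambdaE; apply: (maximizer_regularize (hK f)) => //.
by rewrite -energyE ?h2 ?lambdaE//; case: np.
Qed.

Local Notation lambda := (lambda beta W1 W2).
Local Notation ystar := (ystar beta W1 W2).

Let ng f : normalized mu (ground f). Proof. by case: (groundP f). Qed.
Let sg f : sqi mu (ground f). Proof. by case: (ng f). Qed.
Let g_gt0 f x : 0 < ground f x. Proof. by case: (groundP f) => _ ->. Qed.
Let opT_ground f x : opT mu (boltz f) link (ground f) x = lambda f * ground f x.
Proof. by case: (groundP f) => _ _ ->. Qed.

(** * Moments and decay of ground states *)

Lemma boltz_shift f h x : boltz (f + h) x = boltz f x * expR (beta / 2 * h * x).
Proof. by rewrite /boltz -expRD; congr expR; rewrite /W1f; field. Qed.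

Lemma sqr_le_cosh (t : R) : t ^+ 2 <= 4 * (expR t + expR (- t)).
Proof.
wlog t0 : t / 0 <= t.
  move=> h; have [/h//|/ltW t0] := leP 0 t.
  by have := h (- t); rewrite oppr_ge0 sqrrN opprK (addrC (expR (- t))); apply.
have -> : expR t = expR (t / 2) ^+ 2 by rewrite expr2 -expRD; congr expR; field.
have h : 1 + t / 2 <= expR (t / 2) by exact: expR_ge1Dx.
have := expR_gt0 (- t).
by have : (t / 2) ^+ 2 <= expR (t / 2) ^+ 2; [rewrite lerXn2r ?nnegrE ?expR_ge0 //; lra|lra].
Qed.

(** Shifting the force by 1 and -1 multiplies the squared weight by [exp (beta x)] and
    [exp (- beta x)], whose sum dominates [x^2]. *)
Lemma x_boltz_sqr_le f x : (x * boltz f x) ^+ 2 <=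
  4 / beta ^+ 2 * (boltz (f + 1) x ^+ 2 + boltz (f - 1) x ^+ 2).
Proof.
have -> : boltz (f + 1) x ^+ 2 = boltz f x ^+ 2 * expR (beta * x).
  by rewrite boltz_shift exprMn; congr (_ * _); rewrite expr2 -expRD; congr expR; field.
have -> : boltz (f - 1) x ^+ 2 = boltz f x ^+ 2 * expR (- (beta * x)).
  by rewrite boltz_shift exprMn; congr (_ * _); rewrite expr2 -expRD; congr expR; field.
have b0 : 0 < beta ^+ 2 by rewrite exprn_gt0.
have h : x ^+ 2 <= 4 / beta ^+ 2 * (expR (beta * x) + expR (- (beta * x))).
  by rewrite mulrAC ler_pdivlMr// -exprMn (mulrC x) sqr_le_cosh.
by have := ler_wpM2r (sqr_ge0 (boltz f x)) h; rewrite exprMn -mulrDr; congr (_ <= _); ring.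
Qed.

Lemma sqi_x_boltz f : sqi mu (fun x => x * boltz f x).
Proof.
split; first by apply: measurable_funM => //; exact: measurable_boltz.
apply: (@itg_le _ _ _ mu _ (fun x => 4 / beta ^+ 2 * (boltz (f + 1) x ^+ 2 + boltz (f - 1) x ^+ 2))).
- by apply: measurable_funX; apply: measurable_funM => //; exact: measurable_boltz.
- by apply: itgZ; apply: itgD; [case: (sqi_boltz (f + 1))|case: (sqi_boltz (f - 1))].
- by move=> x; rewrite ger0_norm ?sqr_ge0// x_boltz_sqr_le.
Qed.

Let N f := ip mu (boltz f) (boltz f).
Let Mg f := (lambda f)^-1 * Num.sqrt (expR (- beta * m) ^+ 2 * N f).

(** The eigenvalue equation transfers the pointwise bound on [T] to the ground state. *)
Lemma ground_le f x : ground f x <= Mg f * boltz f x.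
Proof.
have l0 := lambda_gt0 f.
have := opT_bound (hK f) x (sg f); rewrite opT_ground (ng f).2 mulr1.
rewrite (gtr0_norm (mulr_gt0 l0 (g_gt0 f x))) => h.
by rewrite /Mg -mulrA ler_pdivlMl.
Qed.

Let x_ground_le f x : `|x * ground f x| <= `|Mg f * (x * boltz f x)|.
Proof.
have -> : Mg f * (x * boltz f x) = x * (Mg f * boltz f x) by ring.
rewrite (normrM x (ground f x)) (normrM x (Mg f * boltz f x)).
apply: ler_wpM2l => //; rewrite gtr0_norm//.
by rewrite (le_trans (ground_le f x))// ler_norm.
Qed.

Lemma sqi_x_ground f : sqi mu (fun x => x * ground f x).
Proof.
apply: (sqi_le _ (sqiZ (Mg f) (sqi_x_boltz f))); last exact: x_ground_le.
by apply: measurable_funM => //; exact: sqi_measurable (sg f).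
Qed.

Lemma ystarE f : ystar f = ip mu (fun x => x * ground f x) (ground f).
Proof.
have [_ _ _ ae] := groundP f.
have pe : ystar f = \int[mu]_x (x * ground f x ^+ 2).
  apply: ae_eq_Int.
  - apply: measurable_funM => //; apply: measurable_funX.
    have [u [nu fu u0]] := exists_maximizer (hK f).
    have [h1 _ _] : positive_maximizer beta W1 W2 f (psi beta W1 W2 f).
      rewrite /psi; case: xgetP => [v _ //|/(_ u)]; case; split => //.
        exact/unit_L2P.
      by rewrite energyE ?lambdaE//; case: nu.
    by have /unit_L2P [[]] := h1.
  - apply: measurable_funM => //; apply: measurable_funX.
    exact: sqi_measurable (sg f).
  - by apply: (ae1_imp _ ae) => x /= ->.
by rewrite pe; apply: eq_Int => x; ring.
Qed.

Lemma ground_form f : form mu (boltz f) link (ground f) (ground f) = lambda f.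
Proof.
rewrite (form_opT (hK f) (sg f) (sg f)).
rewrite (_ : opT _ _ _ _ = fun x => lambda f * ground f x).
  by rewrite ipZl// (ng f).2 mulr1.
by apply/funext => x; exact: opT_ground.
Qed.

Lemma ground_x_form f :
  form mu (boltz f) link (ground f) (fun x => x * ground f x) = lambda f * ystar f.
Proof.
rewrite (form_opT (hK f) (sg f) (sqi_x_ground f)).
rewrite (_ : opT _ _ _ _ = fun x => lambda f * ground f x).
  by rewrite ipZl//; [rewrite ipC ystarE|exact: sqi_x_ground].
by apply/funext => x; exact: opT_ground.
Qed.

(** * The tangent inequality for the top eigenvalue *)

Lemma ker_shift f h z :
  ker (boltz (f + h)) link z = ker (boltz f) link z * expR (beta / 2 * h * (z.1 + z.2)).
Proof.
rewrite /ker !boltz_shift.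
have -> : expR (beta / 2 * h * (z.1 + z.2)) = expR (beta / 2 * h * z.1) * expR (beta / 2 * h * z.2).
  by rewrite -expRD; congr expR; ring.
ring.
Qed.

(** Integrand at force [f + h] with its exponential factor replaced by the tangent line at
    [beta * h * ystar f], the mean of the exponent. The linear term integrates to zero, which is
    Jensen's inequality in integrated form. *)
Let tangent f h (z : R * R) := ground f z.1 * ground f z.2 * ker (boltz f) link z *
  (expR (beta * h * ystar f) * (1 + beta / 2 * h * (z.1 + z.2) - beta * h * ystar f)).

Let tangentE f h z : tangent f h z =
  expR (beta * h * ystar f) * (1 - beta * h * ystar f) *
    (ground f z.1 * ground f z.2 * ker (boltz f) link z) +
  (expR (beta * h * ystar f) * (beta / 2 * h) *
    (z.1 * ground f z.1 * ground f z.2 * ker (boltz f) link z) +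
  expR (beta * h * ystar f) * (beta / 2 * h) *
    (ground f z.1 * (z.2 * ground f z.2) * ker (boltz f) link z)).
Proof.
rewrite /tangent; move: (ker _ _ z) (ground f z.1) (ground f z.2) (ystar f).
by move=> k g1 g2 y; ring.
Qed.

Let itg_tangent f h : itg m2 (tangent f h).
Proof.
rewrite (funext (tangentE f h)).
apply: itgD; first exact: (itgZ _ (itg_form (hK f) (sg f) (sg f))).
apply: itgD; first exact: (itgZ _ (itg_form (hK f) (sqi_x_ground f) (sg f))).
exact: (itgZ _ (itg_form (hK f) (sg f) (sqi_x_ground f))).
Qed.

Let Int_tangent f h : \int[m2]_z tangent f h z = expR (beta * h * ystar f) * lambda f.
Proof.
rewrite (funext (tangentE f h)).
have i1 := itg_form (hK f) (sg f) (sg f).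
have i2 := itg_form (hK f) (sqi_x_ground f) (sg f).
have i3 := itg_form (hK f) (sg f) (sqi_x_ground f).
rewrite (IntD (itgZ _ i1) (itgD (itgZ _ i2) (itgZ _ i3))).
rewrite (IntD (itgZ _ i2) (itgZ _ i3)) (IntZ _ i1) (IntZ _ i2) (IntZ _ i3).
have e1 := ground_form f; have e2 := ground_x_form f.
have e3 := form_sym (hK f) (sqi_x_ground f) (sg f); rewrite e2 in e3.
transitivity (expR (beta * h * ystar f) * (1 - beta * h * ystar f) *
    form mu (boltz f) link (ground f) (ground f) +
  (expR (beta * h * ystar f) * (beta / 2 * h) *
    form mu (boltz f) link (fun x => x * ground f x) (ground f) +
  expR (beta * h * ystar f) * (beta / 2 * h) *
    form mu (boltz f) link (ground f) (fun x => x * ground f x))); first by [].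
by rewrite e1 e3 e2; field.
Qed.

Let expR_tangent (t t0 : R) : expR t0 * (1 + t - t0) <= expR t.
Proof.
have -> : expR t = expR t0 * expR (t - t0) by rewrite -expRD; congr expR; ring.
by rewrite ler_pM2l ?expR_gt0// -addrA expR_ge1Dx.
Qed.

Let expR_tangent_lt (t t0 : R) : t != t0 -> expR t0 * (1 + t - t0) < expR t.
Proof.
move=> tt0; have -> : expR t = expR t0 * expR (t - t0).
  by rewrite -expRD; congr expR; ring.
by rewrite ltr_pM2l ?expR_gt0// -addrA expR_gt1Dx// subr_eq0.
Qed.

Let gker_gt0 f z : 0 < ground f z.1 * ground f z.2 * ker (boltz f) link z.
Proof. by apply: mulr_gt0; [apply: mulr_gt0|exact: ker_gt0 (hK f) z]. Qed.

Let tangent_le f h z :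
  tangent f h z <= ground f z.1 * ground f z.2 * ker (boltz (f + h)) link z.
Proof.
rewrite ker_shift /tangent (mulrA _ (ker (boltz f) link z)).
apply: ler_wpM2l; first exact: ltW (gker_gt0 f z).
exact: expR_tangent.
Qed.

Lemma ground_form_shift_ge f h : expR (beta * h * ystar f) * lambda f <=
  form mu (boltz (f + h)) link (ground f) (ground f).
Proof.
rewrite -Int_tangent; apply: le_Int; first exact: itg_tangent.
  exact: (itg_form (hK (f + h)) (sg f) (sg f)).
exact: tangent_le.
Qed.

Lemma ground_form_shift_gt f h : h != 0 -> expR (beta * h * ystar f) * lambda f <
  form mu (boltz (f + h)) link (ground f) (ground f).
Proof.
move=> h0; rewrite lt_neqAle ground_form_shift_ge andbT; apply/eqP => e.
have it := itg_tangent f h; have ig := itg_form (hK (f + h)) (sg f) (sg f).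
have I0 : \int[m2]_z (ground f z.1 * ground f z.2 * ker (boltz (f + h)) link z
    - tangent f h z) = 0.
  rewrite (IntB ig it) Int_tangent e; exact: subrr.
have d0 z : 0 <= ground f z.1 * ground f z.2 * ker (boltz (f + h)) link z - tangent f h z.
  by rewrite subr_ge0 tangent_le.
have := Int_eq0 (itgB ig it) d0 I0.
(* Equality would force [z.1 + z.2 = 2 * ystar f] almost everywhere, which fails throughout the
   square over []ystar f, ystar f + 1]]. *)
have y1 : ystar f < ystar f + 1 by rewrite ltrDl.
move=> /(lebesgue_ae2_exists y1) [z [/andP[z1 _] /andP[z2 _]]] /eqP.
rewrite gt_eqF// subr_gt0 ker_shift /tangent (mulrA _ (ker (boltz f) link z)).
rewrite (ltr_pM2l (gker_gt0 f z)); apply: expR_tangent_lt.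
have -> : beta * h * ystar f = beta / 2 * h * (2 * ystar f) by field.
have c0 : beta / 2 * h != 0 by rewrite mulf_neq0// gt_eqF// divr_gt0.
by rewrite (inj_eq (mulfI c0)) gt_eqF//; lra.
Qed.

Let form_le_lambda f u : normalized mu u -> form mu (boltz f) link u u <= lambda f.
Proof.
by move=> [su u1]; have := form_le_lam (hK f) su; rewrite u1 mulr1 lambdaE.
Qed.

Lemma lambda_tangent f h : expR (beta * h * ystar f) * lambda f <= lambda (f + h).
Proof. exact: le_trans (ground_form_shift_ge f h) (form_le_lambda _ (ng f)). Qed.

Lemma lambda_tangent_lt f h : h != 0 ->
  expR (beta * h * ystar f) * lambda f < lambda (f + h).
Proof.
by move=> h0; exact: lt_le_trans (ground_form_shift_gt f h0) (form_le_lambda _ (ng f)).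
Qed.

(** * Continuity of the elongation in the force *)

Let X f := ip mu (fun x => x * boltz f x) (fun x => x * boltz f x).

Let boltz_sqr_le f h x : `|h| <= 1 ->
  boltz (f + h) x ^+ 2 <= boltz (f + 1) x ^+ 2 + boltz (f - 1) x ^+ 2.
Proof.
rewrite ler_norml => /andP[h1 h2].
rewrite !boltz_shift !exprMn -mulrDr ler_pM2l ?exprn_gt0 ?expR_gt0//.
have e t : expR (beta / 2 * t * x) ^+ 2 = expR (beta * (t * x)).
  by rewrite expr2 -expRD; congr expR; field.
rewrite !e mul1r mulN1r.
have [x0|x0] := leP 0 x.
  apply: (@le_trans _ _ (expR (beta * x))); last by rewrite lerDl expR_ge0.
  by rewrite ler_expR ler_pM2l// ler_piMl.
apply: (@le_trans _ _ (expR (beta * - x))); last by rewrite lerDr expR_ge0.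
by rewrite ler_expR ler_pM2l// mulrC -[leRHS]mulrN1 ler_wnM2l// ltW.
Qed.

Let moment_le f h (p : R -> R) : `|h| <= 1 -> (forall t, sqi mu (fun x => p x * boltz t x)) ->
  ip mu (fun x => p x * boltz (f + h) x) (fun x => p x * boltz (f + h) x) <=
  ip mu (fun x => p x * boltz (f + 1) x) (fun x => p x * boltz (f + 1) x) +
  ip mu (fun x => p x * boltz (f - 1) x) (fun x => p x * boltz (f - 1) x).
Proof.
move=> h1 sp.
have i t := itgM (sp t) (sp t).
rewrite /ip -(IntD (i _) (i _)); apply: (le_Int (i _) (itgD (i _) (i _))) => x.
have := ler_wpM2l (sqr_ge0 (p x)) (boltz_sqr_le f x h1).
by rewrite -!expr2 !exprMn mulrDr.
Qed.

(** Uniformity for [|h| <= 1]: [ground_le] reduces the moment to those of [boltz], dominated by the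
    forces [f + 1] and [f - 1], and to a lower bound on [lambda (f + h)], which the tangent
    inequality at [f] provides. *)
Let x_ground_bounded f : exists2 Q, 0 <= Q & forall h, `|h| <= 1 ->
  ip mu (fun x => x * ground (f + h) x) (fun x => x * ground (f + h) x) <= Q.
Proof.
pose N1 := N (f + 1) + N (f - 1); pose X1 := X (f + 1) + X (f - 1).
pose l := lambda f * expR (- (beta * `|ystar f|)).
have l0 : 0 < l by rewrite mulr_gt0 ?lambda_gt0 ?expR_gt0.
have N10 : 0 <= N1 by apply: addr_ge0; exact: ip_ge0.
have X10 : 0 <= X1 by apply: addr_ge0; exact: ip_ge0.
have Q0 : 0 <= l ^- 2 * (expR (- beta * m) ^+ 2 * N1) * X1.
  by rewrite !mulr_ge0// ?invr_ge0 ?sqr_ge0.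
exists (l ^- 2 * (expR (- beta * m) ^+ 2 * N1) * X1) => // h h1.
have ll : l <= lambda (f + h).
  apply: le_trans (lambda_tangent f h); rewrite /l mulrC ler_pM2r ?lambda_gt0//.
  rewrite ler_expR -mulrA -mulrN ler_pM2l// lerNl -mulNr.
  apply: (le_trans (ler_norm _)); rewrite normrM normrN.
  by rewrite ler_piMl.
have NN : N (f + h) <= N1.
  have := @moment_le f h (cst 1) h1.
  have e t : (fun x => cst 1 x * boltz t x) = boltz t by apply/funext => x; rewrite mul1r.
  rewrite !e; apply => t; rewrite e; exact: sqi_boltz.
have XX : X (f + h) <= X1 by exact: (@moment_le f h (fun x => x) h1 sqi_x_boltz).
apply: (@le_trans _ _ (Mg (f + h) ^+ 2 * X (f + h))).
  rewrite -(ip_sqrZ _ (sqi_x_boltz (f + h))); apply: le_Int.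
  - exact: (itgM (sqi_x_ground (f + h)) (sqi_x_ground (f + h))).
  - by apply: itgM; apply: sqiZ; exact: sqi_x_boltz.
  - by move=> x; apply: le_sqr_norm; exact: x_ground_le.
have Ng : 0 <= N (f + h) by exact: ip_ge0.
apply: ler_pM; [exact: sqr_ge0|exact: ip_ge0| |exact: XX].
rewrite /Mg exprMn sqr_sqrtr ?mulr_ge0 ?sqr_ge0//.
apply: ler_pM.
- by rewrite exprn_ge0// invr_ge0 ltW// lambda_gt0.
- by rewrite mulr_ge0// sqr_ge0.
- rewrite exprVn lef_pV2 ?posrE ?exprn_gt0//; last exact: lambda_gt0.
  by rewrite lerXn2r ?nnegrE// ltW// lambda_gt0.
- by apply: ler_wpM2l; first exact: sqr_ge0.
Qed.

(** Tangent inequalities from [f + h] to [f] and back show that the ground state at [f + h] almost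
    maximizes the form at [f], hence is close to the ground state there. *)
Lemma ystar_continuous_at f e : 0 < e ->
  exists2 de, 0 < de & forall h, `|h| <= de -> `|ystar (f + h) - ystar f| <= e.
Proof.
move=> e0; have [Q Q0 xQ] := x_ground_bounded f.
have l0 := lambda_gt0 f.
have yQ h : `|h| <= 1 -> `|ystar (f + h)| <= Q + 1.
  move=> h1; have := cauchy_schwarz (sqi_x_ground (f + h)) (sg (f + h)).
  rewrite -ystarE (ng (f + h)).2 mulr1 => /le_trans /(_ (xQ h h1)) yy.
  rewrite -(@ler_pXn2r _ 2%N) ?nnegrE ?addr_ge0// real_normK ?num_real//.
  exact: le_trans yy (le_sqrD1 Q0).
(* The final Cauchy-Schwarz bound is this quantity times [4 * Q]; adding 1 avoids division by
   zero. *)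
have e1 : 0 < e ^+ 2 / (4 * Q + 1) by rewrite divr_gt0 ?exprn_gt0// ltr_wpDl// mulr_ge0.
have [d0 d0_gt0 gap] := near_maximizers_close (hK f) e1.
(* Both elongations are at most [Q + 1] in absolute value, so the form drops below [lambda f] by at
   most [lambda f * beta * d1 * 2 (Q + 1) = d0]. *)
pose d1 := d0 / (lambda f * beta * (2 * (Q + 1))).
have d1_gt0 : 0 < d1 by rewrite divr_gt0// !mulr_gt0// ltr_wpDl.
exists (Num.min 1 d1); first by rewrite lt_min ltr01.
move=> h; rewrite le_min => /andP[h1 hd].
have Q1 : 0 < Q + 1 by rewrite ltr_wpDl.
have y0 : `|ystar f| <= Q + 1 by have := yQ 0; rewrite normr0 addr0; exact.
have y1 := yQ h h1.
have near_max : lam mu (boltz f) link - d0 <=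
    form mu (boltz f) link (ground (f + h)) (ground (f + h)).
  have := ground_form_shift_ge (f + h) (- h); rewrite addrK; apply: le_trans.
  have := lambda_tangent f h.
  rewrite -(ler_pM2l (expR_gt0 (beta * - h * ystar (f + h)))); apply: le_trans.
  rewrite mulrA -expRD -lambdaE.
  set t := (X in expR X).
  have t1 : - (beta * (d1 * (2 * (Q + 1)))) <= t.
    rewrite lerNl (_ : - t = beta * (h * (ystar (f + h) - ystar f))); last first.
      by rewrite /t; move: (ystar f) (ystar (f + h)) => y2 y3; ring.
    rewrite ler_pM2l//; apply: (le_trans (ler_norm _)); rewrite normrM.
    apply: (ler_pM (normr_ge0 _) (normr_ge0 _) hd).
    apply: (le_trans (ler_normB _ _)).
    rewrite mulr_natl mulr2n; exact: (lerD y1 y0).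
  have := ler_wpM2r (ltW l0) (le_trans (lerD (lexx 1) t1) (expR_ge1Dx t)).
  apply: le_trans; rewrite mulrDl mul1r lerD2l mulNr lerN2.
  rewrite /d1; move: (lambda f) l0 => l l0; rewrite le_eqVlt; apply/orP; left.
  by apply/eqP; field; rewrite !lt0r_neq0.
have := gap _ _ (ng (f + h)) (ng f) (fun x => ltW (g_gt0 (f + h) x))
  (fun x => ltW (g_gt0 f x)) near_max.
have -> : lam mu (boltz f) link - d0 <= form mu (boltz f) link (ground f) (ground f).
  by rewrite ground_form lambdaE gerBl ltW.
move=> /(_ isT) close.
have sx := sqi_x_ground (f + h); have sx0 := sqi_x_ground f.
have sd := sqiB (sg (f + h)) (sg f).
(* Factor the difference of squares under the integral, so that only the first factor has to be
   small. *)
have -> : ystar (f + h) - ystar f =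
    ip mu (fun x => ground (f + h) x - ground f x)
          (fun x => x * ground (f + h) x + x * ground f x).
  rewrite !ystarE -(IntB (itgM sx (sg (f + h))) (itgM sx0 (sg f))).
  apply: eq_Int => x; move: (ground (f + h) x) (ground f x) => g1 g2; ring.
rewrite -(@ler_pXn2r _ 2%N) ?nnegrE ?(ltW e0)// real_normK ?num_real//.
apply: (le_trans (cauchy_schwarz sd (sqiD sx sx0))).
have X0 : ip mu (fun x => x * ground f x) (fun x => x * ground f x) <= Q.
  by have := xQ 0; rewrite normr0 addr0; exact.
have := ip_sqrD_le sx sx0; have := xQ h h1 => X1 X2.
have X3 := le_trans X2 (lerD (ler_wpM2l (ler0n R 2) X1) (ler_wpM2l (ler0n R 2) X0)).
apply: (le_trans (ler_pM (ip_ge0 _ _) (ip_ge0 _ _) close X3)).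
rewrite mulrAC ler_pdivrMr; last by rewrite ltr_wpDl// mulr_ge0.
by rewrite ler_pM2l ?exprn_gt0// -mulrDl -natrD lerDl.
Qed.

(* If [s * ystar <= Y] for all forces, the tangent inequality bounds the growth
   of [lambda (s r)] by [exp (beta r Y)], but trial functions supported in
   [s x > Y + 1] make it grow at least like [exp (beta r (Y + 1))]. *)
Lemma ystar_unbounded s Y : s = 1 \/ s = -1 -> exists f, Y < s * ystar f.
Proof.
move=> s1; apply: contrapT => nex.
have yY f : s * ystar f <= Y by rewrite leNgt; apply/negP => h; apply: nex; exists f.
have ss : s * s = 1 by case: s1 => ->; rewrite ?mulrNN mulr1.
pose chi x := Num.max 0 (Num.min 1 (s * x - (Y + 1))).
have chi0 x : 0 <= chi x by rewrite le_max lexx.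
have chi1 x : chi x <= 1 by rewrite ge_max ler01 ge_min lexx.
have chi_supp x : 0 < chi x -> Y + 1 < s * x.
  by rewrite lt_max ltxx /= lt_min subr_gt0 => /andP[].
pose u x := chi x * ground 0 x.
have u_ge0 x : 0 <= u x by rewrite mulr_ge0// ltW// g_gt0.
have u_le x : u x <= ground 0 x by rewrite ler_piMl// ltW// g_gt0.
have su : sqi mu u.
  apply: (sqi_le _ (sg 0)).
    apply: measurable_funM; last exact: sqi_measurable (sg 0).
    apply: measurable_maxr => //; apply: measurable_minr => //.
    by apply: measurable_funB => //; exact: measurable_funM.
  by move=> x; rewrite !ger0_norm// ltW.
have u1 : ip mu u u <= 1.
  rewrite -(ng 0).2; apply: le_Int.
  - exact: itgM.
  - exact: itgM (sg 0) (sg 0).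
  - by move=> x; apply: le_sqr_norm; rewrite !ger0_norm// ltW.
have u_neq0 : 0 < ip mu u u.
  rewrite lt_neqAle ip_ge0 andbT; apply/eqP => /esym /(ip_eq0 su) ae0.
  have [x xs ux] : exists2 x, 0 < chi x & u x = 0.
    (* Intervals of positive measure on which [chi] is positive; for [s = -1] the closed end is kept
       away from [- (Y + 1)]. *)
    case: s1 => es.
    - have l : Y + 1 < Y + 2 by rewrite ltrD2l ltr1n.
      have [x /andP[x1 _] ux] := lebesgue_ae_exists l ae0.
      by exists x => //; rewrite lt_max lt_min ltr01 subr_gt0 es mul1r x1 orbT.
    - have l : - (Y + 3) < - (Y + 2) by rewrite ltrN2 ltrD2l ltr_nat.
      have [x /andP[_ x1] ux] := lebesgue_ae_exists l ae0.
      exists x => //; rewrite lt_max lt_min ltr01 subr_gt0 es mulN1r ltrNr.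
      by rewrite (le_lt_trans x1) ?orbT// ltrN2 ltrD2l ltr1n.
  by move/eqP: ux; rewrite mulf_eq0 !gt_eqF.
have c0 := form_gt0 (hK 0) su u_neq0 u_ge0.
set c := form _ _ _ _ _ in c0.
have growth r : 0 <= r -> expR (beta * r * (Y + 1)) * c <= lambda (0 + s * r).
  move=> r0; apply: (@le_trans _ _ (form mu (boltz (0 + s * r)) link u u)).
    rewrite /c -(IntZ _ (itg_form (hK 0) su su)); apply: le_Int.
    - exact: (itgZ _ (itg_form (hK 0) su su)).
    - exact: (itg_form (hK (0 + s * r)) su su).
    - move=> z; rewrite (ker_shift 0 (s * r) z) (mulrC (expR _)) (mulrA _ (ker _ _ z)).
      have k0 := ltW (ker_gt0 (hK 0) z).
      have [z1|z1] := leP (chi z.1) 0.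
        have -> : u z.1 = 0 by rewrite /u (_ : chi _ = 0) ?mul0r//; apply/eqP; rewrite eq_le z1 chi0.
        by rewrite !mul0r.
      have [z2|z2] := leP (chi z.2) 0.
        have -> : u z.2 = 0 by rewrite /u (_ : chi _ = 0) ?mul0r//; apply/eqP; rewrite eq_le z2 chi0.
        by rewrite !(mulr0, mul0r).
      apply: ler_wpM2l; first by rewrite mulr_ge0// mulr_ge0.
      rewrite ler_expR.
      have -> : beta / 2 * (s * r) * (z.1 + z.2) = beta * r * ((s * z.1 + s * z.2) / 2).
        by field.
      apply: ler_wpM2l; first by rewrite mulr_ge0// ltW.
      rewrite ler_pdivlMr// mulr_natr mulr2n.
      by apply: lerD; apply: ltW; exact: chi_supp.
  have := form_le_lam (hK (0 + s * r)) su => /le_trans; apply.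
  by rewrite -lambdaE ler_piMr// ltW// lambda_gt0.
have upper r : 0 <= r -> lambda (0 + s * r) <= expR (beta * r * Y) * lambda 0.
  move=> r0; have := lambda_tangent (0 + s * r) (- (s * r)); rewrite addrK.
  rewrite -(ler_pM2l (expR_gt0 (beta * r * Y))); apply: le_trans.
  rewrite mulrA -expRD ler_peMl ?(ltW (lambda_gt0 _))//.
  rewrite -[leLHS]expR0 ler_expR.
  have -> : beta * r * Y + beta * - (s * r) * ystar (0 + s * r) =
     beta * r * (Y - s * ystar (0 + s * r)).
    by move: (ystar _) => y; ring.
  by rewrite mulr_ge0 ?subr_ge0// mulr_ge0// ltW.
(* Chosen so that [(1 + beta * r) * c = lambda 0 + c], whereas the two growth bounds give
   [exp (beta * r) * c <= lambda 0]. *)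
pose r := lambda 0 / (c * beta).
have r0 : 0 <= r by rewrite divr_ge0 ?mulr_ge0// ltW// lambda_gt0.
have := le_trans (growth r r0) (upper r r0).
have -> : beta * r * (Y + 1) = beta * r * Y + beta * r by ring.
rewrite expRD -mulrA ler_pM2l ?expR_gt0// => h.
have := ler_wpM2r (ltW c0) (expR_ge1Dx (beta * r)) => /le_trans /(_ h).
have -> : (1 + beta * r) * c = lambda 0 + c.
  by rewrite /r; move: (lambda 0) => l; field; rewrite !lt0r_neq0.
by rewrite gerDl leNgt c0.
Qed.
End Model.

(** * Legendre transform *)

Section LegendreTransform.
Context {R : realType}.
Variables (beta : R) (L y : R -> R).
Hypothesis beta_gt0 : 0 < beta.
Hypothesis L_tangent : forall f h, h != 0 -> L f + beta * h * y f < L (f + h).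
Hypothesis y_continuous : continuous y.
Hypothesis y_unbounded : forall x, (exists f, x < y f) /\ (exists f, y f < x).

Let leg x xi := xi * x - (L (xi / beta) - L 0).
Let F x := beta^-1 * sup [set leg x xi | xi in setT].

(** Add the strict tangent inequalities from [f] to [g] and from [g] to [f]. *)
Let y_lt f g : f < g -> y f < y g.
Proof.
move=> fg; have h0 : g - f != 0 by rewrite subr_eq0 gt_eqF.
have h1 : f - g != 0 by rewrite subr_eq0 lt_eqF.
have := L_tangent f h0; have := L_tangent g h1.
rewrite !(addrC _ (_ - _)) !subrK => a b.
have : 0 < beta * (g - f) * (y g - y f) by lra.
by rewrite pmulr_rgt0 ?subr_gt0// mulr_gt0// subr_gt0.
Qed.

Let y_le f g : f <= g -> y f <= y g.
Proof. by rewrite le_eqVlt => /predU1P[->//|/y_lt/ltW]. Qed.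

Let y_surj x : exists f, y f = x.
Proof.
have [[g xg] [f fx]] := y_unbounded x.
have fg : f <= g.
  by rewrite leNgt; apply/negP => /y_lt; rewrite ltNge (ltW (lt_trans fx xg)).
have yfg := ltW (lt_trans fx xg).
have [c _ <-] : exists2 c, c \in `[f, g] & y c = x; last by exists c.
apply: (IVT fg); first exact: continuous_subspaceT.
by rewrite (min_l yfg) (max_r yfg) (ltW fx) (ltW xg).
Qed.

Let leg_lt x f xi : y f = x -> xi != beta * f -> leg x xi < leg x (beta * f).
Proof.
move=> yf xf; have h0 : xi / beta - f != 0.
  rewrite subr_eq0; apply: contra xf => /eqP <-.
  by rewrite mulrC divfK// gt_eqF.
have := L_tangent f h0; rewrite (addrC f) subrK yf /leg.
have -> : beta * f / beta = f by rewrite mulrC mulKf// gt_eqF.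
have -> : beta * (xi / beta - f) * x = (xi - beta * f) * x.
  by field; rewrite gt_eqF.
by lra.
Qed.

Let leg_le x f xi : y f = x -> leg x xi <= leg x (beta * f).
Proof.
by move=> yf; have [->//|/(leg_lt yf)/ltW] := eqVneq xi (beta * f).
Qed.

Let FE f : F (y f) = beta^-1 * leg (y f) (beta * f).
Proof.
congr (_ * _); apply/eqP; rewrite eq_le; apply/andP; split.
  apply: ge_sup; first by exists (leg (y f) 0); exists 0.
  by move=> _ [xi _ <-]; exact: leg_le.
(* Boundedness of the set, from [leg_le], keeps [sup] from taking its default value. *)
apply: sup_ubound; last by exists (beta * f).
by exists (leg (y f) (beta * f)) => _ [xi _ <-]; exact: leg_le.
Qed.

(** The point [beta * f] remains a competitor in the transform at [y g], so [f] is a subgradient of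
    [F] at [y f]. *)
Let F_subgradient f g : (y g - y f) * f <= F (y g) - F (y f).
Proof.
have := leg_le (beta * f) (erefl (y g)); rewrite !FE.
have b0 : 0 < beta^-1 by rewrite invr_gt0.
rewrite -(ler_pM2l b0) => h.
rewrite lerBrDr; apply: le_trans h; rewrite le_eqVlt; apply/orP; left.
by apply/eqP; rewrite /leg; field; rewrite gt_eqF.
Qed.

Let y_inv_continuous f e : 0 < e -> exists2 de, 0 < de &
  forall g, `|y g - y f| < de -> `|g - f| < e.
Proof.
move=> e0; have l1 : y (f - e) < y f by apply: y_lt; rewrite gtrBl.
have l2 : y f < y (f + e) by apply: y_lt; rewrite ltrDl.
exists (Num.min (y f - y (f - e)) (y (f + e) - y f)).
  by rewrite lt_min !subr_gt0 l1.
move=> g; rewrite lt_min !ltr_norml => /andP[/andP[a _] /andP[_ b]].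
rewrite ltrBlDl ltrBrDl; apply/andP; split; rewrite ltNge; apply/negP => /y_le h.
  by move: a; rewrite opprB ltrD2r ltNge h.
by move: b; rewrite ltrD2r ltNge h.
Qed.

Let F_derive f : is_derive (y f) 1 F f.
Proof.
have cv : (fun h => h^-1 *: ((F \o shift (y f)) (h *: 1) - F (y f))) @ 0^' --> f.
  apply/cvgrPdist_lt => e e0; have [de de0 close] := y_inv_continuous f e0.
  near=> h.
  have h0 : h != 0 by near: h; exact: nbhs_dnbhs_neq.
  have hd : `|h| < de by near: h; exact: dnbhs0_lt.
  rewrite /= -[h%:A]/(h * 1) mulr1 -[_ *: _]/(_ * _).
  have [g yg] := y_surj (h + y f); rewrite -yg.
  have hE : h = y g - y f by rewrite yg addrK.
  have gf : `|g - f| < e by apply: close; rewrite -hE.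
  (* Used in both orders, this gives [h * f <= F (y g) - F (y f) <= h * g] for either sign of [h];
     the difference quotient is thus within [|g - f|] of [f]. *)
  have a := F_subgradient f g; have b := F_subgradient g f.
  rewrite -hE in a; have {}b : F (y g) - F (y f) <= h * g.
    by move: b; rewrite -opprB -hE mulNr -(opprB (F (y g))) lerN2.
  apply: le_lt_trans gf; rewrite -(@ler_pM2l _ `|h|) ?normr_gt0//.
  rewrite -!normrM mulrBr mulrA mulfV// mul1r mulrBr.
  have c : h * f <= h * g by exact: le_trans a b.
  rewrite ler0_norm ?subr_le0// ger0_norm ?subr_ge0// opprB.
  by rewrite lerD2r.
apply: DeriveDef; first by apply/cvg_ex; exists f.
exact: cvg_lim cv.
Unshelve. all: by end_near. Qed.

Lemma legendre_inverse :
  (forall x, exists xi, unique (fun xi => forall eta, leg x eta <= leg x xi) xi /\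
     is_derive x 1 F (xi / beta)) /\
  (forall x, y (derive1 F x) = x) /\ (forall f, derive1 F (y f) = f).
Proof.
have dF f : derive1 F (y f) = f.
  by rewrite derive1E; have := F_derive f => -[_ ->].
split; [|split=> // x].
- move=> x; have [f <-] := y_surj x; exists (beta * f); split.
    split=> [eta|eta max]; first exact: leg_le.
    apply/eqP; rewrite eq_sym; apply: contraT => /(leg_lt (erefl (y f))).
    by rewrite ltNge max.
  rewrite (_ : beta * f / beta = f) ?F_derive//.
  by rewrite mulrC mulKf// gt_eqF.
- by have [f <-] := y_surj x; rewrite dF.
Qed.

End LegendreTransform.

Lemma admissible_of_moments (R : realType) (beta : R) (W1 W2 : R -> R) (p m : R) :
  0 < beta -> loc_integrable W1 -> loc_integrable W2 ->
  {ae @lebesgue_measure R, forall x, m <= W2 x} ->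
  (forall f : R, (\int[@lebesgue_measure R]_x
     ((1 + `|x| `^ p) * expR (- beta * W1f W1 f x))%:E < +oo)%E) ->
  admissible beta W1 W2 m.
Proof.
move=> b0 [mW1 _ _] [mW2 _ _] mW moments; split => // f.
have me : measurable_fun setT (fun x => expR (- beta * W1f W1 f x)).
  apply: (measurableT_comp (@measurable_expR R)); apply: measurable_funM => //.
  by apply: measurable_funB => //; exact: measurable_funM.
apply/integrableP; split; first exact/measurable_EFinP.
apply: le_lt_trans (moments f); apply: ge0_le_integral => //.
- by apply/measurable_EFinP; apply: measurableT_comp.
- apply/measurable_EFinP; apply: measurable_funM => //; apply: measurable_funD => //.
  apply: (measurableT_comp (measurable_powR p)).
  exact: (@normr_measurable R setT).
- move=> x _; rewrite lee_fin /= ger0_norm ?expR_ge0//.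
  by rewrite ler_peMl ?expR_ge0// lerDl powR_ge0.
Qed.

Theorem mainTheorem2 (R : realType) (beta : R) (W1 W2 : R -> R) (p : R)
  (beta_gt0 : 0 < beta)
  (W1_loc : loc_integrable W1)
  (W2_loc : loc_integrable W2)
  (expW2_loc : W11_loc (fun x => expR (- beta * W2 x)))
  (p_ge1 : 1 <= p)
  (W2_lower : ess_bounded_below W2)
  (W2_moment : (\int[@lebesgue_measure R]_x
     ((1 + `|x| `^ p) * expR (- beta * W2 x))%:E < +oo)%E)
  (W1f_lower : forall f : R, ess_bounded_below (W1f W1 f))
  (expW1f_loc : forall f : R, W11_loc (fun x => expR (- beta * W1f W1 f x)))
  (W1f_moment : forall f : R, (\int[@lebesgue_measure R]_x
     ((1 + `|x| `^ p) * expR (- beta * W1f W1 f x))%:E < +oo)%E)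
  (lnLambda_convex : @convex_function R R^o setT
     (fun xi => ln (Lambda beta W1 W2 xi)))
  (sigma2_neq0 : {ae @lebesgue_measure R, forall f, sigma2 beta W1 W2 f <> 0}) :
  let F := F_infty beta W1 W2 in
  let y := ystar beta W1 W2 in
  (forall x : R, exists xi : R,
     unique (sup_attained_at beta W1 W2 x) xi /\
     is_derive x 1 F (xi / beta)) /\
  (forall x : R, y (derive1 F x) = x) /\
  (forall f : R, derive1 F (y f) = f).
Proof.
have [m mW] := W2_lower.
have hM := admissible_of_moments beta_gt0 W1_loc W2_loc mW W1f_moment.
pose L f := ln (lambda beta W1 W2 f).
have l0 := lambda_gt0 hM.
have legE x xi : legendre beta W1 W2 x xi = xi * x - (L (xi / beta) - L 0).
  by rewrite /legendre (LambdaE hM) ln_div ?posrE ?l0.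
have legendreE : legendre beta W1 W2 = fun x xi => xi * x - (L (xi / beta) - L 0).
  by apply/funext => x; apply/funext => xi; exact: legE.
rewrite /F_infty /sup_attained_at legendreE.
apply: legendre_inverse => //.
- move=> f h h0; have := lambda_tangent_lt hM f h0.
  rewrite -ltr_ln ?posrE ?mulr_gt0 ?expR_gt0//.
  by rewrite lnM ?posrE ?expR_gt0// expRK addrC.
- move=> f; apply/cvgrPdist_le => e e0.
  have [de de0 close] := ystar_continuous_at hM f e0.
  near=> g; have fg : f + (g - f) = g by rewrite addrC subrK.
  rewrite distrC -{1}fg; apply: close.
  by rewrite distrC; near: g; exact: cvgr_dist_le.
- move=> x; split.
    by have [f] := ystar_unbounded hM x (or_introl erefl); rewrite mul1r; exists f.
  have [f] := ystar_unbounded hM (- x) (or_intror erefl).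
  by rewrite mulN1r ltrN2; exists f.
Unshelve. all: by end_near. Qed.
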